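(* Let $\zeta>0$ be an ordinal. (i) For each $1\leqslant p\leqslant\infty$, $\bigcup_{\xi<\omega^\zeta}\mathfrak{NP}_p^\xi$ is an operator ideal. (ii) $\mathfrak{NP}_1^{\omega^\zeta}$ is a closed operator ideal. (iii) For each $1\leqslant p\leqslant\infty$, $\mathfrak{NP}_p^1$ is a closed operator ideal. (iv) If $\zeta$ is infinite, $\mathfrak{NP}_\infty^\zeta$ is a closed operator ideal.
   Context: ''Operator'' means bounded linear operator; $\mathfrak{L}(X,Y)$ is the space of operators $X\to Y$ between Banach spaces and $B_X$ is the closed unit ball. A class of operators is closed if each of its components in $\mathfrak{L}(X,Y)$ is norm closed. For sequences of the same length in Banach spaces, $(u_i)\lesssim_K(v_i)$ means $\|\sum a_iu_i\|\leqslant K\|\sum a_iv_i\|$ for all (finitely supported) scalars $(a_i)$. A tree on a set $\Lambda$ is a set $T$ of finite sequences in $\Lambda$ (the empty sequence allowed) closed under initial segments. Put $T'=T\setminus MAX(T)$, where $MAX(T)$ is the set of members maximal for the initial segment order; $T^0=T$, $T^{\xi+1}=(T^\xi)'$, $T^\xi=\bigcap_{\zeta<\xi}T^\zeta$ for limit $\xi$. The order $o(T)$ is the least ordinal $\xi$ with $T^\xi=\varnothing$ if one exists, and $o(T)=\infty$ otherwise, where $\xi<\infty$ for every ordinal $\xi$. For $1\leqslant p\leqslant\infty$ let $(e_i)$ be the canonical basis of $\ell_p$ (of $c_0$ if $p=\infty$). For $A\in\mathfrak{L}(X,Y)$ and $K\geqslant1$ let $T_p(A,X,Y,K)$ be the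 tree of all finite sequences $(x_i)_{i=1}^n$ in $B_X$ (including the empty one) with $(x_i)_{i=1}^n\lesssim_1(e_i)_{i=1}^n$ and $(e_i)_{i=1}^n\lesssim_K(Ax_i)_{i=1}^n$. Put $\mathbf{NP}_p(A,X,Y)=\sup_{K\geqslant1}o(T_p(A,X,Y,K))$. For an ordinal $\xi$, $\mathfrak{NP}_p^\xi$ is the class of all operators $A:X\to Y$ ($X,Y$ Banach spaces) with $\mathbf{NP}_p(A,X,Y)\leqslant\omega^\xi$. *)

(* Defs.v *)
From HB Require Import structures.
From mathcomp Require Import all_boot all_order all_algebra.
From mathcomp Require Import complex.
From mathcomp Require Import all_classical all_reals all_analysis.

Set Implicit Arguments.
Unset Strict Implicit.
Unset Printing Implicit Defensive.

Import Order.TTheory GRing.Theory Num.Theory.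
Import numFieldNormedType.Exports.

Local Open Scope classical_set_scope.
Local Open Scope ring_scope.

(* [Osup f] denotes the least ordinal strictly greater than all the [f i].
   Two terms denote the same ordinal iff each is [ole] the other; everything
   below is invariant under that equivalence. *)
Inductive Ord : Type := Osup (U : Type) (f : U -> Ord).

Fixpoint ole (a b : Ord) {struct a} : Prop :=
  match a, b with
  | Osup U f, Osup V g => forall i : U, exists j : V, ole (f i) (g j)
  end.

Definition olt (a b : Ord) : Prop :=
  match b with Osup V g => exists j : V, ole a (g j) end.

Definition oeq (a b : Ord) : Prop := ole a b /\ ole b a.

Definition ozero : Ord := Osup (fun x : False => match x with end).
Definition osucc (a : Ord) : Ord := Osup (fun _ : unit => a).

(* Least upper bound of a family. *)
Definition oidx (a : Ord) : Type := match a with Osup U _ => U end.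
Definition obranch (a : Ord) : oidx a -> Ord :=
  match a with Osup _ f => f end.
Definition olub (U : Type) (f : U -> Ord) : Ord :=
  Osup (fun x : {i : U & oidx (f i)} => obranch (projT2 x)).
Definition omax (a b : Ord) : Ord := olub (fun c : bool => if c then a else b).

Definition oone : Ord := osucc ozero.
Definition oomega : Ord := Osup (fun n : nat => iter n osucc ozero).

Fixpoint oadd (a b : Ord) {struct b} : Ord :=
  match b with Osup V g => omax a (Osup (fun j => oadd a (g j))) end.

Fixpoint omul (a b : Ord) {struct b} : Ord :=
  match b with Osup V g => olub (fun j => oadd (omul a (g j)) a) end.

(* omega ^ b *)
Fixpoint opow (b : Ord) : Ord :=
  match b with
  | Osup V g => omax oone (olub (fun j => omul (opow (g j)) oomega))
  end.

(* Ordinals extended by a largest element [None] = infinity. *)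
Definition eord : Type := option Ord.

Definition eole (a b : eord) : Prop :=
  match a, b with
  | _, None => True
  | None, Some _ => False
  | Some a, Some b => ole a b
  end.

Definition eolub (U : Type) (f : U -> eord) : eord :=
  if `[< exists i, f i = None >] then None
  else Some (olub (fun i => odflt ozero (f i))).

Section Trees.
Variable L : eqType.
Implicit Types (T : set (seq L)) (s t : seq L).

Definition MAX T : set (seq L) :=
  [set s | T s /\ forall t, T t -> prefix s t -> t = s].

Definition derive_tree T : set (seq L) := T `\` MAX T.

(* One clause covers 0, successors and limits: see [derived0], [derivedS]
   and [derived_lim] below. *)
Fixpoint derived T (xi : Ord) : set (seq L) :=
  match xi with
  | Osup U f =>
    [set s | T s /\ forall i : U, derive_tree (derived T (f i)) s]
  end.

Definition is_tree_order T (xi : Ord) : Prop :=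
  derived T xi = set0 /\ forall eta, derived T eta = set0 -> ole xi eta.

Definition tree_order T : eord :=
  match pselect (exists xi, is_tree_order T xi) with
  | left h => Some (projT1 (cid h))
  | right _ => None
  end.

End Trees.

Inductive scalar_kind := RealScalars | ComplexScalars.

Definition scal (R : realType) (k : scalar_kind) : numFieldType :=
  match k with RealScalars => R | ComplexScalars => R[i] end.

Definition real_part (R : realType) (k : scalar_kind) : scal R k -> R :=
  match k with RealScalars => id | ComplexScalars => fun z => complex.Re z end.

Section Operators.
Variables (R : realType) (k : scalar_kind).
Local Notation F := (scal R k).
Local Notation banach := (completeNormedModType F).

(* The library norm takes its values in the scalar field; [nrm] is the same
   norm as an element of [R]. *)
Definition nrm (X : normedModType F) (x : X) : R := real_part `|x|.
Definition absv (a : F) : R := real_part `|a|.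

Definition unit_ball (X : banach) : set X := [set x | nrm x <= 1].

Definition bounded_op (X Y : banach) (f : X -> Y) : Prop :=
  exists M : R, forall x, nrm (f x) <= M * nrm x.

Record operator (X Y : banach) : Type := Operator {
  op_map :> {linear X -> Y};
  op_bounded : bounded_op op_map }.

Definition opnorm (X Y : banach) (f : X -> Y) : R :=
  sup [set nrm (f x) | x in @unit_ball X].

Definition opclass : Type := forall X Y : banach, operator X Y -> Prop.

Definition finite_rank (X Y : banach) (A : operator X Y) : Prop :=
  exists s : seq Y, forall x, exists a : nat -> F,
    A x = \sum_(i < size s) a i *: s`_i.

Definition operator_ideal (C : opclass) : Prop :=
  [/\ forall (X Y : banach) (A : operator X Y), finite_rank A -> C X Y A,
      forall (X Y : banach) (A B S : operator X Y) (a : F),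
        C X Y A -> C X Y B -> (forall x, S x = a *: A x + B x) -> C X Y S &
      forall (W X Y Z : banach) (B : operator W X) (A : operator X Y)
        (D : operator Y Z) (P : operator W Z),
        C X Y A -> (forall w, P w = D (A (B w))) -> C W Z P].

Definition closed_class (C : opclass) : Prop :=
  forall (X Y : banach) (A : operator X Y),
    (forall e : R, 0 < e ->
      exists B, C X Y B /\ opnorm (fun x => A x - B x) < e) ->
    C X Y A.

Definition closed_operator_ideal (C : opclass) : Prop :=
  operator_ideal C /\ closed_class C.

(* Norm of [\sum_(i < n) a_i e_i] in l_p (in c_0 when p = +oo). *)
Definition lpnorm (p : \bar R) (n : nat) (a : nat -> F) : R :=
  match p with
  | r%:E => (\sum_(i < n) absv (a i) `^ r) `^ r^-1
  | +oo%E => \big[Num.max/0]_(i < n) absv (a i)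
  | -oo%E => 0
  end.

Definition lcnorm (X : banach) (u : seq X) (a : nat -> F) : R :=
  nrm (\sum_(i < size u) a i *: u`_i).

(* The relation [(u_i) <~_K (v_i)], each sequence being given by the norms of
   its linear combinations. *)
Definition dominated (K : R) (N M : (nat -> F) -> R) : Prop :=
  forall a, N a <= K * M a.

Definition Tp (p : \bar R) (X Y : banach) (A : operator X Y) (K : R) :
    set (seq X) :=
  [set s : seq X | [/\ forall x : X, x \in s -> unit_ball x,
    dominated 1 (lcnorm s) (lpnorm p (size s)) &
    dominated K (lpnorm p (size s)) (lcnorm [seq A x | x <- s])]].

Definition NP (p : \bar R) (X Y : banach) (A : operator X Y) : eord :=
  eolub (fun K : {K : R | 1 <= K} => tree_order (Tp p A (sval K))).

Definition NPclass (p : \bar R) (xi : Ord) : opclass :=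
  fun X Y A => eole (NP p A) (Some (opow xi)).

End Operators.

Section OrdinalFacts.

Lemma ole_refl a : ole a a.
Proof. by elim: a => U f IH /= i; exists i. Qed.

Lemma ole_trans b a c : ole a b -> ole b c -> ole a c.
Proof.
elim: a b c => U f IH [V g] [W h] /= fg gh i.
have [j fj] := fg i; have [m gm] := gh j.
by exists m; exact: IH fj gm.
Qed.

Lemma ole_total a b : ole a b \/ olt b a.
Proof.
elim: a b => U f IH b.
have [|nb] := pselect (exists i, ole b (f i)); first by right.
left; case: b nb => V g nb /= i; apply: contrapT => ng.
have H j : olt (g j) (f i).
  by have [fg|//] := IH i (g j); case: ng; exists j.
by apply: nb; exists i; case: (f i) H => W h H j; exact: H.
Qed.

Lemma olt_le_trans b a c : olt a b -> ole b c -> olt a c.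
Proof.
case: b c => V g [W h] /= [j aj] /(_ j)[m gm].
by exists m; exact: ole_trans aj gm.
Qed.

Lemma olub_ub (U : Type) (f : U -> Ord) i : ole (f i) (olub f).
Proof.
have : ole (Osup (@obranch (f i))) (olub f).
  by move=> j; exists (existT _ i j); exact: ole_refl.
by case: (f i).
Qed.

Lemma olub_least (U : Type) (f : U -> Ord) b :
  (forall i, ole (f i) b) -> ole (olub f) b.
Proof.
case: b => V g fb [i j] /=; move: (fb i) j.
by case: (f i) => W h /= hg j; exact: hg.
Qed.

Lemma olt_wf : well_founded olt.
Proof.
move=> b; suff: forall a, ole a b -> Acc olt a by apply; exact: ole_refl.
elim: b => V g IH a ab; constructor => c ca.
by have /= [j cj] := olt_le_trans ca ab; exact: IH cj.
Qed.

Lemma ole_max_l a b : ole a (omax a b).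
Proof. exact: (@olub_ub _ (fun c : bool => if c then a else b) true). Qed.

Lemma ole_max_r a b : ole b (omax a b).
Proof. exact: (@olub_ub _ (fun c : bool => if c then a else b) false). Qed.

Lemma omax_least a b c : ole a c -> ole b c -> ole (omax a b) c.
Proof. by move=> ac bc; apply: olub_least => -[]. Qed.

Lemma ole_zero a : ole ozero a. Proof. by case: a => U f []. Qed.

Lemma ole_succ a : ole a (osucc a).
Proof.
elim: a => U f IH /= i; exists tt; apply: ole_trans (IH i) _.
by move=> ?; exists i; exact: ole_refl.
Qed.

Lemma oadd0 a : oeq (oadd a ozero) a.
Proof.
split; last exact: ole_max_l.
by apply: omax_least; [exact: ole_refl|case: a => U f /= -[]].
Qed.

Lemma oaddS a b : oeq (oadd a (osucc b)) (osucc (oadd a b)).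
Proof.
split; last exact: ole_max_r.
apply: omax_least; last exact: ole_refl.
apply: ole_trans (ole_succ _); case: b => V g; exact: ole_max_l.
Qed.

Lemma omul0 a : oeq (omul a ozero) ozero.
Proof. by split; [case=> -[]|exact: ole_zero]. Qed.

Lemma omulS a b : oeq (omul a (osucc b)) (oadd (omul a b) a).
Proof.
split; last exact: (@olub_ub _ (fun _ : unit => oadd (omul a b) a) tt).
by apply: olub_least => _; exact: ole_refl.
Qed.

Lemma opow0 : oeq (opow ozero) oone.
Proof.
split; last exact: ole_max_l.
by apply: omax_least; [exact: ole_refl|case=> -[]].
Qed.

Lemma opow_ge1 b : ole oone (opow b).
Proof. by case: b => V g; exact: ole_max_l. Qed.

Lemma ole_addr a b : ole b (oadd a b).
Proof.
elim: b => V g IH; apply: ole_trans (ole_max_r _ _) => j.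
by exists j; exact: IH.
Qed.

Lemma ole_mul_omega a : ole a (omul a oomega).
Proof.
apply: ole_trans (olub_ub _ 0%N).
exact: ole_addr.
Qed.

Lemma opowS b : oeq (opow (osucc b)) (omul (opow b) oomega).
Proof.
split.
  apply: omax_least; first exact: ole_trans (opow_ge1 b) (ole_mul_omega _).
  by apply: olub_least => _; exact: ole_refl.
apply: ole_trans (ole_max_r _ _).
exact: (@olub_ub _ (fun _ : unit => omul (opow b) oomega) tt).
Qed.

Definition olimit (xi : Ord) : Prop :=
  olt ozero xi /\ forall eta, olt eta xi -> olt (osucc eta) xi.

Lemma oadd_lim a xi c : olimit xi ->
  (forall eta, olt eta xi -> ole (oadd a eta) c) -> ole (oadd a xi) c.
Proof.
move=> [xi0 xiS] ac; have a_c : ole a c.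
  exact: ole_trans (oadd0 a).2 (ac _ xi0).
case: xi xi0 xiS ac => V g xi0 xiS ac; apply: omax_least => //.
have gc j : olt (oadd a (g j)) c.
  have /xiS/ac : olt (g j) (Osup g) by exists j; exact: ole_refl.
  move=> /(ole_trans (oaddS a (g j)).2).
  by case: (c) => W h /(_ tt).
by case: c gc {ac a_c} => W h gc j; exact: gc.
Qed.

Lemma omul_lim a xi c : olimit xi ->
  (forall eta, olt eta xi -> ole (omul a eta) c) -> ole (omul a xi) c.
Proof.
move=> [xi0 xiS] ac; case: xi xi0 xiS ac => V g xi0 xiS ac.
apply: olub_least => j; apply: ole_trans (omulS a (g j)).2 _.
by apply: ac; apply: xiS; exists j; exact: ole_refl.
Qed.

Lemma opow_lim xi c : olimit xi ->
  (forall eta, olt eta xi -> ole (opow eta) c) -> ole (opow xi) c.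
Proof.
move=> [xi0 xiS] ac; case: xi xi0 xiS ac => V g xi0 xiS ac.
apply: omax_least; first exact: ole_trans (opow_ge1 _) (ac _ xi0).
apply: olub_least => j; apply: ole_trans (opowS (g j)).2 _.
by apply: ac; apply: xiS; exists j; exact: ole_refl.
Qed.

End OrdinalFacts.

Section TreeFacts.
Variable L : eqType.
Implicit Types (T : set (seq L)).

Lemma derive_treeS T U : T `<=` U -> derive_tree T `<=` derive_tree U.
Proof.
move=> TU s [Ts nmax]; split; first exact: TU.
by move=> [_ smax]; apply: nmax; split=> // t Tt; apply: smax; exact: TU.
Qed.

Lemma derived_anti T xi eta :
  ole xi eta -> derived T eta `<=` derived T xi.
Proof.
elim: xi eta => U f IH [V g] /= le s [Ts Ds]; split=> // i.
by have [j fg] := le i; exact: derive_treeS (IH _ _ fg) _ (Ds j).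
Qed.

Lemma derived0 T : derived T ozero = T.
Proof. by apply/seteqP; split=> [s []//|s Ts]; split=> // -[]. Qed.

Lemma derived_sub T xi : derived T xi `<=` T.
Proof. by case: xi => U f s []. Qed.

Lemma derivedS T xi : derived T (osucc xi) = derive_tree (derived T xi).
Proof.
apply/seteqP; split=> [s [_ /(_ tt)]//|s Ds].
by split=> //; apply: derived_sub (Ds.1).
Qed.

(* The index universe of [Ord] lies above that of [L], so [Ord] itself is too
   large to be the argument of [set] or the index type of a [\bigcap]. *)
Lemma derived_lim T xi s : olimit xi ->
  derived T xi s <-> forall eta, olt eta xi -> derived T eta s.
Proof.
move=> [xi0 xiS]; split=> [Ds eta lt|Ds].
  apply: derived_anti Ds.
  apply: ole_trans (ole_succ _) _.
  have := xiS _ lt; case: (xi) => V g [j ej] i.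
  exists j; apply: ole_trans ej; exact: ole_succ.
case: xi xi0 xiS Ds => V g xi0 xiS Ds; split.
  by rewrite -(derived0 T); exact: Ds.
move=> j; rewrite -derivedS; apply: Ds; apply: xiS.
by exists j; exact: ole_refl.
Qed.

(* In particular o(T) is an ordinal, represented in [Ord], as soon as T has no
   infinite branch. *)
Lemma derived_wf T :
  well_founded (fun t s => [/\ T t, prefix s t & t <> s]) ->
  exists xi, derived T xi = set0.
Proof.
move=> wf.
suff H : forall s, exists xi, ~ derived T xi s.
  have [h hP] := choice H; exists (olub h); apply/seteqP; split=> // s Ds.
  by apply: (hP s); apply: derived_anti Ds; exact: olub_ub.
move=> s; elim: s / (wf s) => s _ IH.
have H t : exists xi, [/\ T t, prefix s t & t <> s] -> ~ derived T xi t.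
  have [/IH[xi nt]|no] := pselect [/\ T t, prefix s t & t <> s].
    by exists xi.
  by exists ozero => /no.
have [h hP] := choice H; exists (osucc (olub h)); rewrite derivedS.
move=> [Ds]; apply; split=> // t Dt pst; apply: contrapT => ts.
apply: (hP t); first by split=> //; exact: derived_sub Dt.
by apply: derived_anti Dt; exact: olub_ub.
Qed.

Lemma tree_orderP T xi : derived T xi = set0 ->
  exists2 o, tree_order T = Some o & is_tree_order T o.
Proof.
move=> T0; have ex : exists xi, is_tree_order T xi.
  elim/(well_founded_ind olt_wf): xi T0 => xi IH T0.
  have [[eta [lt eta0]]|no] :=
    pselect (exists eta, olt eta xi /\ derived T eta = set0).
    exact: IH lt eta0.
  exists xi; split=> // eta eta0; have [//|lt] := ole_total xi eta.
  by case: no; exists eta.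
rewrite /tree_order; case: pselect => // h.
by exists (projT1 (cid h)) => //; case: cid.
Qed.

End TreeFacts.

(* Main.v *)
Require Import Defs.
From mathcomp Require Import all_boot all_order all_algebra complex.
From mathcomp Require Import all_classical all_reals all_analysis.
From mathcomp Require Import lra ring.

(** Say that a tree has order greater than a when its derived tree of order a
    contains the empty sequence.  An operator A belongs to NP_p^xi exactly when
    no tree T_p(A, K) has order greater than omega ^ xi ([NPclassP]).

    Closedness and stability under composition hold for all p and xi: in
    T_p(A, K) the upper estimate turns an operator perturbation of norm at most
    1/(2K) into an error of half the lower estimate, so K is at most doubled
    ([derived_perturb]), and composing with bounded operators multiplies K by a
    constant ([derived_compose]).  The sequences of the trees of a finite rank
    operator are not longer than a spanning sequence of its range
    ([finite_rank_size]).  What is left are the sums S = a A + B.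

    For the sums, the starting point is that normalized l_p blocks of a
    sequence of T_p(S, K) form again a sequence of T_p(S, K).  If T_p(A, 1/eps)
    does not have order greater than alpha, then inside every subtree of
    T_p(S, K) of order greater than alpha some branch carries a normalized
    block z with |A z| <= eps: otherwise that subtree would embed in
    T_p(A, 1/eps).  A tree of order greater than alpha * beta is a tree of
    order beta of trees of order alpha, so that one can choose such blocks
    z_0, z_1, ... along a tree of order beta.  If the eps_j are small, A is
    negligible on the blocks and B has to satisfy the lower estimate there:
    T_p(B, 2K) has order greater than beta ([derived_sum]).  This gives three
    of the four assertions:
    - with alpha = omega ^ x, beta = omega ^ y and eps_j of the size of 2^-j,
      it gives A in NP^x, B in NP^y => S in NP^(x + y), and the ordinals below
      omega ^ zeta are stable under addition ([NPclass_sum]);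
    - for p = 1 the same eps can be used for all the blocks, because the sum of
      the |c_j| eps is controlled by the l_1 norm of c.  So only one tree of A
      and one tree of B occur for a given K.  Their orders are not greater than
      omega ^ x and omega ^ y for some x, y < omega ^ zeta, and x + y is below
      omega ^ zeta again ([NPclass_sum_l1]);
    - for xi = 1 the order beta of the tree of B is a natural number m, only m
      blocks are used, and eps can be chosen after m ([NPclass_sum_oone]).

    For p = oo another argument is needed since omega ^ zeta is not stable under
    multiplication.  On a sequence of T_oo(S, K) each vector x has |A x| or
    |B x| bounded below.  Colouring the vectors accordingly, a tree of order
    greater than omega ^ zeta has a one-coloured tree of subsequences of order
    greater than omega ^ zeta ([splits_opow]).  Say that the colour is that of
    A.  In c_0 the lower estimate only asks that the coordinates be bounded,
    and this holds as soon as the sequence (A x_i) is basic and bounded below.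
    A basic sequence is built by choosing each vector in a long finite segment
    of a branch ([next_basic]), which costs a factor omega on the left of the
    order, and omega * omega ^ zeta = omega ^ (1 + zeta) = omega ^ zeta for
    infinite zeta ([derived_c0], [NPclass_sum_c0]). *)

Import Order.TTheory GRing.Theory Num.Theory.
Import numFieldNormedType.Exports.

Set Implicit Arguments.
Unset Strict Implicit.
Unset Printing Implicit Defensive.

Local Open Scope classical_set_scope.
Local Open Scope ring_scope.

(** * Ordinal arithmetic *)

Lemma oltW a b : olt a b -> ole a b.
Proof.
case: b => V g [j aj]; apply: ole_trans aj _; apply: ole_trans (ole_succ _) _.
by move=> ?; exists j; exact: ole_refl.
Qed.

Lemma ole_lt_trans a b c : ole a b -> olt b c -> olt a c.
Proof. by case: c => V g ab [j bj]; exists j; apply: ole_trans bj. Qed.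

Lemma olt_succ a : olt a (osucc a).
Proof. by exists tt; exact: ole_refl. Qed.

Lemma osucc_le a b : olt a b -> ole (osucc a) b.
Proof. by case: b => V g [j aj] i; exists j. Qed.

Lemma olt_olub (U : Type) (f : U -> Ord) a :
  olt a (olub f) -> exists i, olt a (f i).
Proof.
by move=> [[i j] /= aj]; exists i; case: (f i) j aj => W h /= j aj; exists j.
Qed.

Lemma ole_omax_sup a (V : Type) (g : V -> Ord) c :
  ole a c -> (forall j, olt (g j) c) -> ole (omax a (Osup g)) c.
Proof.
by move=> ac gc; apply: omax_least => //; case: c gc {ac} => W h gc j; exact: gc.
Qed.

Lemma oadd_mono_r a b c : ole b c -> ole (oadd a b) (oadd a c).
Proof.
elim: b c => V g IH [W h] bc; apply: omax_least; first exact: ole_max_l.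
apply: ole_trans (ole_max_r _ _) => j; have [m gm] := bc j.
by exists m; exact: IH.
Qed.

Lemma oadd_strict a b c : olt b c -> olt (oadd a b) (oadd a c).
Proof.
case: c => W h [j bj]; apply: olt_le_trans (ole_max_r _ _).
by exists j; exact: oadd_mono_r.
Qed.

Lemma oadd_mono_l a a' b : ole a a' -> ole (oadd a b) (oadd a' b).
Proof.
move=> aa'; elim: b => V g IH; apply: omax_least.
  exact: ole_trans aa' (ole_max_l _ _).
by apply: ole_trans (ole_max_r _ _) => j; exists j; exact: IH.
Qed.

Lemma ole_addl a b : ole a (oadd a b).
Proof. by case: b => V g; exact: ole_max_l. Qed.

Lemma oaddA_le a b c : ole (oadd (oadd a b) c) (oadd a (oadd b c)).
Proof.
elim: c => V g IH; apply: ole_omax_sup.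
  by apply: oadd_mono_r; exact: ole_addl.
move=> j; apply: ole_lt_trans (IH j) _.
by apply/oadd_strict/oadd_strict; exists j; exact: ole_refl.
Qed.

Lemma oaddA_ge a b c : ole (oadd a (oadd b c)) (oadd (oadd a b) c).
Proof.
have sup d e f :
    ole (oadd a d) f -> ole (oadd a e) f -> ole (oadd a (omax d e)) f.
  move=> df ef; apply: ole_omax_sup => [|[[] i]].
  - exact: ole_trans (ole_addl _ _) df.
  - apply: olt_le_trans df; apply: oadd_strict.
    by case: d i => ? ? i; exists i; exact: ole_refl.
  - apply: olt_le_trans ef; apply: oadd_strict.
    by case: e i => ? ? i; exists i; exact: ole_refl.
elim: c => V g IH; apply: sup; first exact: ole_addl.
apply: ole_omax_sup => [|j].
  exact: ole_trans (ole_addl _ _) (ole_addl _ _).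
by apply: ole_lt_trans (IH j) _; apply: oadd_strict; exists j; exact: ole_refl.
Qed.

Lemma omul_mono_l a b c : ole a b -> ole (omul a c) (omul b c).
Proof.
move=> ab; elim: c => V g IH; apply: olub_least => j.
apply: ole_trans (oadd_mono_l _ (IH j)) _; apply: ole_trans (oadd_mono_r _ ab) _.
exact: (olub_ub (fun j => oadd (omul b (g j)) b)).
Qed.

Lemma omul_olub a (U : Type) (f : U -> Ord) c :
  (forall i, ole (omul a (f i)) c) -> ole (omul a (olub f)) c.
Proof.
move=> fc; apply: olub_least => -[i j] /=; apply: ole_trans (fc i).
case: (f i) j => W h j.
exact: (olub_ub (fun j => oadd (omul a (h j)) a)).
Qed.

Lemma omulDr_le a b c : ole (omul a (oadd b c)) (oadd (omul a b) (omul a c)).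
Proof.
elim: c => V g IH; apply: omul_olub => -[]; first exact: ole_addl.
apply: olub_least => j; apply: ole_trans (oadd_mono_l _ (IH j)) _.
apply: ole_trans (oaddA_le _ _ _) _; apply: oadd_mono_r.
exact: (olub_ub (fun j => oadd (omul a (g j)) a)).
Qed.

Lemma omulA_le a b c : ole (omul a (omul b c)) (omul (omul a b) c).
Proof.
elim: c => V g IH; apply: omul_olub => j.
apply: ole_trans (omulDr_le _ _ _) _; apply: ole_trans (oadd_mono_l _ (IH j)) _.
exact: (olub_ub (fun j => oadd (omul (omul a b) (g j)) (omul a b))).
Qed.

Lemma oadd0l_le a : ole (oadd ozero a) a.
Proof.
elim: a => V g IH; apply: ole_omax_sup => [|j]; first exact: ole_zero.
by exists j; exact: IH.
Qed.

Lemma omul_oone_le a : ole (omul a oone) a.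
Proof.
apply: olub_least => _; apply: ole_trans (oadd_mono_l _ (omul0 a).1) _.
exact: oadd0l_le.
Qed.

Lemma opow_mono a b : ole a b -> ole (opow a) (opow b).
Proof.
elim: a b => V g IH [W h] ab; apply: omax_least; first exact: opow_ge1.
apply: olub_least => j; have [m gm] := ab j.
apply: ole_trans (ole_max_r _ _).
apply: ole_trans (olub_ub (fun j => omul (opow (h j)) oomega) m).
by apply: omul_mono_l; exact: IH.
Qed.

Lemma opow_mul_omega a b : olt a b -> ole (omul (opow a) oomega) (opow b).
Proof. by move=> /osucc_le/opow_mono; apply: ole_trans (opowS _).2. Qed.

(** This is how a product of orders, which comes from nesting two trees, turns
    into a sum of exponents. *)
Lemma omul_opow_le a b : ole (omul (opow a) (opow b)) (opow (oadd a b)).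
Proof.
elim: b => V g IH; apply: omul_olub => -[].
  apply: ole_trans (omul_oone_le _) _; apply: opow_mono; exact: ole_addl.
apply: omul_olub => j; apply: ole_trans (omulA_le _ _ _) _.
apply: ole_trans (omul_mono_l _ (IH j)) _; apply: opow_mul_omega.
by apply: oadd_strict; exists j; exact: ole_refl.
Qed.

Definition onat (n : nat) : Ord := iter n osucc ozero.

Lemma omul_onat_lt a n : olt ozero a -> olt (omul a (onat n)) (omul a oomega).
Proof.
move=> a0; apply: ole_lt_trans (ole_addl _ ozero) _.
apply: olt_le_trans (oadd_strict _ a0) _.
exact: (olub_ub (fun n => oadd (omul a (onat n)) a)).
Qed.

Lemma opow_gt0 a : olt ozero (opow a).
Proof. exact: olt_le_trans (olt_succ _) (opow_ge1 _). Qed.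

Lemma omul_onatD_le a m n :
  ole (oadd (omul a (onat m)) (omul a (onat n))) (omul a (onat (n + m))).
Proof.
elim: n => [|n IH].
  apply: ole_trans (oadd_mono_r _ (omul0 a).1) _; exact: (oadd0 _).1.
apply: ole_trans (oadd_mono_r _ (omulS _ _).1) _.
apply: ole_trans (oaddA_ge _ _ _) _; apply: ole_trans (omulS _ _).2.
exact: oadd_mono_l.
Qed.

Lemma olt_opowP a z : olt a (opow z) ->
  ole a ozero \/ exists g, olt g z /\ exists n, ole a (omul (opow g) (onat n)).
Proof.
case: z => V g /olt_olub[[]]; first by move=> [_]; left.
move=> /olt_olub[j /olt_olub[n /oltW an]]; right.
exists (g j); split; first by exists j; exact: ole_refl.
by exists n.+1; apply: ole_trans an (omulS _ _).2.
Qed.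

(** Both ordinals lie below finite multiples of one omega ^ l with l < z, and
    so does their sum. *)
Lemma opow_indecomposable a b z :
  olt a (opow z) -> olt b (opow z) -> olt (oadd a b) (opow z).
Proof.
move=> az bz.
have [a0|[g [gz [m am]]]] := olt_opowP az.
  apply: ole_lt_trans bz; apply: ole_trans (oadd_mono_l _ a0) (oadd0l_le _).
have [b0|[h [hz [n bn]]]] := olt_opowP bz.
  by apply: ole_lt_trans az; apply: ole_trans (oadd_mono_r _ b0) (oadd0 _).1.
have [l [lz gl hl]] : exists l, [/\ olt l z, ole g l & ole h l].
  have [gh|/oltW hg] := ole_total g h.
    by exists h; split=> //; exact: ole_refl.
  by exists g; split=> //; exact: ole_refl.
apply: (@ole_lt_trans _ (omul (opow l) (onat (n + m)))); last first.
  apply: olt_le_trans (opow_mul_omega lz); exact/omul_onat_lt/opow_gt0.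
apply: ole_trans (omul_onatD_le _ _ _).
apply: ole_trans (oadd_mono_l _ _) (oadd_mono_r _ _).
  by apply: ole_trans am _; apply/omul_mono_l/opow_mono.
by apply: ole_trans bn _; apply/omul_mono_l/opow_mono.
Qed.

Lemma ole_omul_oone a : ole a (omul a oone).
Proof. by apply: ole_trans (omulS _ _).2; exact: ole_addr. Qed.

Lemma oone_lt_opow z : olt ozero z -> olt oone (opow z).
Proof.
move=> z0; apply: olt_le_trans (opow_mul_omega z0).
apply: ole_lt_trans (omul_onat_lt 1 (opow_gt0 _)).
exact: ole_trans (opow_ge1 ozero) (ole_omul_oone _).
Qed.

Lemma osucc_mono a b : ole a b -> ole (osucc a) (osucc b).
Proof. by move=> ab [] /=; exists tt. Qed.

Lemma oadd_oone_le a : ole (oadd a oone) (osucc a).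
Proof.
by apply: ole_trans (oaddS _ _).1 _; apply: osucc_mono; exact: (oadd0 _).1.
Qed.

Lemma onat_lt_omega n : olt (onat n) oomega.
Proof. by exists n; exact: ole_refl. Qed.

Lemma opow_oone_le : ole (opow oone) oomega.
Proof.
apply: ole_trans (opowS _).1 _; apply: ole_trans (omul_mono_l _ opow0.1) _.
suff one_mul n : ole (oadd (omul oone (onat n)) oone) (onat n.+1).
  apply: olub_least => n; apply: ole_trans (one_mul n) _.
  exact/oltW/onat_lt_omega.
have step m : ole (omul oone (onat m)) (onat m) ->
    ole (oadd (omul oone (onat m)) oone) (onat m.+1).
  by move=> IHm; apply: ole_trans (@oadd_oone_le _) _; exact: osucc_mono.
elim: n => [|n IH]; apply: step; first exact: (omul0 _).1.
exact: ole_trans (omulS _ _).1 IH.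
Qed.

Lemma olimit_opow z : olt ozero z -> olimit (opow z).
Proof.
move=> z0; split=> [|a az]; first exact: opow_gt0.
apply: ole_lt_trans (opow_indecomposable az (oone_lt_opow z0)).
exact: ole_trans (osucc_mono (oadd0 _).2) (oaddS _ _).2.
Qed.

Lemma onat_lt_opow_oone n : olt (onat n) (opow oone).
Proof.
have [pos lim] := olimit_opow (olt_succ ozero).
by elim: n => [|n IH]; [exact: pos|exact: lim IH].
Qed.

Lemma omul_onat_lt_opow_oone m n : olt (omul (onat m) (onat n)) (opow oone).
Proof.
elim: n => [|n IH].
  exact: ole_lt_trans (omul0 _).1 (opow_gt0 _).
apply: ole_lt_trans (omulS _ _).1 _.
exact: opow_indecomposable IH (onat_lt_opow_oone m).
Qed.

(** Used to absorb a factor omega on the left of omega ^ z; this is where the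
    exponent has to be infinite in the case of c_0. *)
Lemma oadd_oone_infinite z : ole oomega z -> ole (oadd oone z) z.
Proof.
elim: z => V g IH wz; apply: ole_omax_sup => [|j].
  exact: ole_trans (oltW (onat_lt_omega 1)) wz.
have gz : olt (g j) (Osup g) by exists j; exact: ole_refl.
have [/IH|[n gn]] := ole_total oomega (g j).
  by move=> /ole_lt_trans; apply.
have w1 : ole (opow oone) (Osup g) := ole_trans opow_oone_le wz.
apply: olt_le_trans w1; apply: opow_indecomposable.
  exact: oone_lt_opow (olt_succ _).
by apply: ole_lt_trans gn (onat_lt_opow_oone n).
Qed.

(** * Derived trees *)

Definition is_tree (L : eqType) (T : set (seq L)) : Prop :=
  forall s v, T (s ++ v) -> T s.

Section TreeRank.
Variable L : eqType.
Implicit Types (T U : set (seq L)) (s t v : seq L).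

Lemma derive_tree_extends T s v x : T (s ++ x :: v) -> T s -> derive_tree T s.
Proof.
move=> Tsx Ts; split=> // -[_ /(_ _ Tsx (prefix_prefix _ _))/(congr1 size)/eqP].
by rewrite size_cat -[X in _ == X]addn0 eqn_add2l.
Qed.

Lemma is_tree_derived T a : is_tree T -> is_tree (derived T a).
Proof.
move=> treeT; elim: a => V g IH s [|x v]; first by rewrite cats0.
move=> [Tsv Dsv]; split=> [|j]; first exact: treeT Tsv.
have [Dj _] := Dsv j.
exact: derive_tree_extends Dj (IH j _ _ Dj).
Qed.

(** For a tree, being non-maximal is witnessed by an extension with one
    element, since every proper extension passes through one. *)
Lemma derivedP T (V : Type) (g : V -> Ord) s : is_tree T ->
  derived T (Osup g) s <->
  T s /\ forall j, exists x, derived T (g j) (rcons s x).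
Proof.
move=> treeT; split=> -[Ts Ds]; split=> // j; last first.
  have [x Dx] := Ds j; rewrite -cats1 in Dx.
  exact: derive_tree_extends Dx (is_tree_derived treeT Dx).
have [Dj nmax] := Ds j; apply: contrapT => no; apply: nmax; split=> // t Dt.
move=> /prefixP[[|x v] tE]; first by rewrite tE cats0.
case: no; exists x; apply: (is_tree_derived treeT (v := v)).
by rewrite cat_rcons -tE.
Qed.

Lemma derived_olub T (V : Type) (g : V -> Ord) s :
  T s -> (forall i, derived T (g i) s) -> derived T (olub g) s.
Proof.
by move=> Ts Ds; split=> // -[i j] /=; have := Ds i; case: (g i) j => W h j [].
Qed.

(** From s one first performs b steps, all of them inside the derived tree of
    order a, and from the node that is reached a more steps are possible. *)
Lemma derived_oadd T a b s : is_tree T ->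
  derived T (oadd a b) s <-> derived (derived T a) b s.
Proof.
move=> treeT; have treeTa := is_tree_derived (a := a) treeT.
elim: b s => V g IH s; split=> [Ds|/(derivedP _ _ treeTa)[Ts Ds]].
  apply/(derivedP _ _ treeTa); split.
    by apply: derived_anti Ds; exact: ole_addl.
  have := derived_anti (ole_max_r _ _) Ds => /(derivedP _ _ treeT)[_ {}Ds] j.
  by have [x Dx] := Ds j; exists x; apply/IH.
apply: derived_olub => [|[]//]; first exact: derived_sub Ts.
apply/(derivedP _ _ treeT); split=> [|j]; first exact: derived_sub Ts.
by have [x Dx] := Ds j; exists x; apply/IH.
Qed.

Lemma derived_onat T n s : is_tree T -> derived T (onat n) s ->
  exists2 v, size v = n & T (s ++ v).
Proof.
move=> treeT; elim: n s => [|n IH] s.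
  by rewrite derived0; exists [::]; rewrite // cats0.
move=> /(derivedP _ _ treeT)[_ /(_ tt)[x /IH[v vn Tv]]].
by exists (x :: v); rewrite /= ?vn // -cat_rcons.
Qed.

End TreeRank.

Section Transfer.
Variables L M : eqType.

(** If every step in T can be answered by a step in S, the rank can only
    increase. *)
Lemma derived_simulation (T : set (seq L)) (S : set (seq M))
    (rel : seq L -> seq M -> Prop) b s u :
  is_tree T -> is_tree S ->
  (forall s u, T s -> rel s u -> S u) ->
  (forall s u x, T (rcons s x) -> rel s u ->
    exists z, rel (rcons s x) (rcons u z)) ->
  rel s u -> derived T b s -> derived S b u.
Proof.
move=> treeT treeS TS step; elim: b s u => V g IH s u su.
move=> /(derivedP _ _ treeT)[Ts Ds]; apply/(derivedP _ _ treeS).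
split=> [|j]; first exact: TS su.
have [x Dx] := Ds j; have [z uz] := step _ _ _ (derived_sub Dx) su.
by exists z; exact: IH uz Dx.
Qed.

(** A tree of order a * b is a tree of order b of trees of order a.  So it is
    enough to be able to answer with one element of S inside each subtree U of
    order a: what is left of T beyond the node t of U still has the order that
    the rest of the game requires.  The ordinal argument of [rel] is the
    order still to be used; it lets the relation depend on the number of
    steps that remain when b is finite. *)
Lemma derived_thinning (T : set (seq L)) (S : set (seq M))
    (rel : Ord -> seq L -> seq M -> Prop) a b s u :
  is_tree T -> is_tree S ->
  (forall d s u, T s -> rel d s u -> S u) ->
  (forall c d s u (U : set (seq L)), olt c d -> rel d s u ->
    is_tree U -> U `<=` T -> derived U a s ->
    exists t z, U t /\ rel c t (rcons u z)) ->
  rel b s u -> derived T (omul a b) s -> derived S b u.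
Proof.
move=> treeT treeS TS step; elim: b s u => V g IH s u su Ds.
apply/(derivedP _ _ treeS); split=> [|j].
  exact: TS (derived_sub Ds) su.
have /(derived_oadd _ _ _ treeT)Da :
    derived T (oadd (omul a (g j)) a) s.
  by apply: derived_anti Ds; exact: (olub_ub (fun j => oadd (omul a (g j)) a)).
have [||t [z [Dt tz]]] := step (g j) _ _ _ _ _ su _ (@derived_sub _ T _) Da.
- by exists j; exact: ole_refl.
- exact: is_tree_derived.
by exists z; exact: IH tz Dt.
Qed.

End Transfer.

Section Partition.
Variable L : eqType.
Implicit Types (T S : set (seq L)) (s t v : seq L).

(** Indecomposability of g for trees: in a tree of order greater than g whose
    elements are coloured by c, the elements of one colour contain a tree of
    order greater than g.  The nodes u1 and u2 record the elements of each
    colour that were met before s, so that the property can be used again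
    from any node of the tree. *)
Definition splits (g : Ord) : Prop :=
  forall T S1 S2 (c : pred L) s u1 u2, is_tree T -> is_tree S1 -> is_tree S2 ->
    (forall v, T (s ++ v) ->
      S1 (u1 ++ seq.filter c v) /\ S2 (u2 ++ seq.filter (predC c) v)) ->
    derived T g s -> derived S1 g u1 \/ derived S2 g u2.

(** The topmost copy of g is split by hypothesis.  If neither conclusion holds
    at the root, then by induction on m + n it is true at every node of that
    copy that the elements of the first colour can still be continued g * m
    times, and those of the second colour g * n times; so the colour given by
    the splitting of the copy gains one more factor g, a contradiction. *)
Lemma splits_onat g m n T S1 S2 (c : pred L) s u1 u2 : splits g ->
  is_tree T -> is_tree S1 -> is_tree S2 ->
  (forall v, T (s ++ v) ->
    S1 (u1 ++ seq.filter c v) /\ S2 (u2 ++ seq.filter (predC c) v)) ->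
  derived T (omul g (onat (m + n))) s ->
  derived S1 (omul g (onat m)) u1 \/ derived S2 (omul g (onat n)) u2.
Proof.
move=> gP treeT tree1 tree2.
have zero S t : S t -> derived S (omul g (onat 0)) t.
  by move=> St; apply: derived_anti (omul0 _).1 _ _; rewrite derived0.
have [k] := ubnP (m + n); elim: k m n s u1 u2 => // k IH m n s u1 u2 mnk TS Ds.
have := TS [::]; rewrite !cats0 => /(_ (derived_sub Ds))[S1u S2u].
case: m n mnk Ds => [|m] [|n] mnk Ds;
  try by [left; exact: zero|right; exact: zero].
have [|no1] := pselect (derived S1 (omul g (onat m.+1)) u1); first by left.
have [|no2] := pselect (derived S2 (omul g (onat n.+1)) u2); first by right.
rewrite addSn in mnk Ds.
have /(derived_oadd _ _ _ treeT) {}Ds := derived_anti (omulS _ _).2 Ds.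
have S1' := is_tree_derived tree1; have S2' := is_tree_derived tree2.
have TS' v w : T ((s ++ v) ++ w) ->
    S1 ((u1 ++ seq.filter c v) ++ seq.filter c w) /\
    S2 ((u2 ++ seq.filter (predC c) v) ++ seq.filter (predC c) w).
  by rewrite -!catA -!filter_cat; exact: TS.
have keep v : derived T (omul g (onat (m + n.+1))) (s ++ v) ->
    derived S1 (omul g (onat m)) (u1 ++ seq.filter c v) /\
    derived S2 (omul g (onat n)) (u2 ++ seq.filter (predC c) v).
  move=> Dv; split.
    by have [//|/S2'] := IH m n.+1 _ _ _ mnk (TS' v) Dv.
  rewrite addnS -addSn in mnk Dv.
  by have [/S1'|//] := IH m.+1 n _ _ _ mnk (TS' v) Dv.
have [D1|D2] := gP _ _ _ _ _ _ _ (is_tree_derived treeT) (S1' _) (S2' _) keep Ds.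
  left; apply: derived_anti (omulS _ _).1 _ _.
  exact/(derived_oadd _ _ _ tree1).
right; apply: derived_anti (omulS _ _).1 _ _.
exact/(derived_oadd _ _ _ tree2).
Qed.

Lemma splits_ole g h : ole g h -> ole h g -> splits g -> splits h.
Proof.
move=> gh hg gP T S1 S2 c s u1 u2 treeT tree1 tree2 TS /(derived_anti gh) Ds.
by have [D1|D2] := gP _ _ _ _ _ _ _ treeT tree1 tree2 TS Ds;
  [left; exact: derived_anti D1|right; exact: derived_anti D2].
Qed.

Lemma splits_oone : splits oone.
Proof.
move=> T S1 S2 c s u1 u2 treeT tree1 tree2 TS.
move=> /(derivedP _ _ treeT)[_ /(_ tt)[x /derived_sub Tx]].
have one S u y : is_tree S -> S (u ++ [:: y]) -> derived S oone u.
  move=> treeS Sy; apply/(derivedP _ _ treeS); split=> [|_].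
    exact: treeS Sy.
  by exists y; rewrite derived0 -cats1.
rewrite -cats1 in Tx; have := TS _ Tx => /=.
by case: (c x) => /= -[D1 D2]; [left; exact: one D1|right; exact: one D2].
Qed.

(** If both colours fail for omega ^ z, they fail for omega ^ h * n and
    omega ^ h * m with a common h < z, which contradicts the existence of a
    tree of order omega ^ h * (n + m). *)
Lemma splits_opow z : splits (opow z).
Proof.
elim: z => V g IH.
have [[j0 _]|V0] := pselect (exists j : V, True); last first.
  apply: splits_ole splits_oone; first exact: opow_ge1.
  apply: omax_least; first exact: ole_refl.
  by apply: olub_least => j; case: V0; exists j.
move=> T S1 S2 c s u1 u2 treeT tree1 tree2 TS Ds.
have := TS [::]; rewrite !cats0 => /(_ (derived_sub Ds))[S1u S2u].
have fails S u : S u -> ~ derived S (opow (Osup g)) u ->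
    exists j n, ~ derived S (omul (opow (g j)) (onat n)) u.
  move=> Su noS; apply: contrapT => all_j; apply: noS.
  have Dj j n : derived S (omul (opow (g j)) (onat n)) u.
    by apply: contrapT => noS; apply: all_j; exists j, n.
  apply: derived_olub => // -[].
    apply: derived_anti (Dj j0 1).
    exact: ole_trans (opow_ge1 _) (ole_omul_oone _).
  apply: derived_olub => // j; apply: derived_olub => // n.
  by apply: derived_anti (Dj j n.+1); exact: (omulS _ _).2.
have [|/(fails _ _ S1u)[j1 [n1 no1]]] := pselect (derived S1 (opow (Osup g)) u1).
  by left.
have [|/(fails _ _ S2u)[j2 [n2 no2]]] := pselect (derived S2 (opow (Osup g)) u2).
  by right.
have [j [j1j j2j]] : exists j, ole (g j1) (g j) /\ ole (g j2) (g j).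
  have [j12|/oltW j21] := ole_total (g j1) (g j2).
    by exists j2; split=> //; exact: ole_refl.
  by exists j1; split=> //; exact: ole_refl.
have Dj : derived T (omul (opow (g j)) (onat (n1 + n2))) s.
  apply: derived_anti Ds; apply: ole_trans (ole_max_r _ _).
  apply: ole_trans (olub_ub (fun j => omul (opow (g j)) oomega) j).
  exact/oltW/omul_onat_lt/opow_gt0.
have [D1|D2] := splits_onat (IH j) treeT tree1 tree2 TS Dj.
- by case: no1; apply: derived_anti D1; exact/omul_mono_l/opow_mono.
- by case: no2; apply: derived_anti D2; exact/omul_mono_l/opow_mono.
Qed.
End Partition.

Section Limits.
Variable L : eqType.
Implicit Types (T : set (seq L)) (s : seq L).

(** For a limit l, omega ^ l is the supremum of the omega ^ xi with xi < l. *)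
Lemma not_derived_opow_lim T l s : olimit l ->
  ~ derived T (opow l) s -> exists xi, olt xi l /\ ~ derived T (opow xi) s.
Proof.
move=> [l0 lS] noT; apply: contrapT => all_xi.
have {all_xi} D xi : olt xi l -> derived T (opow xi) s.
  by move=> xil; apply: contrapT => noxi; apply: all_xi; exists xi.
apply: noT; have D1 := derived_anti (opow_ge1 _) (D _ l0).
case: l l0 lS D => V g _ lS D; apply: derived_olub => [|[]//].
  exact: derived_sub D1.
apply: derived_olub => [|j]; first exact: derived_sub D1.
apply: derived_anti (D (osucc (g j)) _); first exact: (opowS _).2.
by apply: lS; exists j; exact: ole_refl.
Qed.

Lemma not_derived_opow_oone T s :
  ~ derived T (opow oone) s -> exists n, ~ derived T (onat n) s.
Proof.
move=> noT; apply: contrapT => all_n.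
have {all_n} D n : derived T (onat n) s.
  by apply: contrapT => non; apply: all_n; exists n.
apply: noT; apply: derived_anti opow_oone_le _ _; split=> [|n].
  exact: derived_sub (D 0%N).
by rewrite -derivedS; exact: (D n.+1).
Qed.

End Limits.

(** * Scalars, norms and linear combinations *)

Section Scalars.
Variables (R : realType) (k : scalar_kind).
Local Notation F := (scal R k).

Definition of_real : R -> F :=
  match k return R -> scal R k with
  | RealScalars => id
  | ComplexScalars => fun t => (t%:C)%C
  end.

Lemma real_partD (z w : F) : real_part (z + w) = real_part z + real_part w.
Proof. by rewrite /real_part; case: k z w => //= z w; rewrite raddfD. Qed.

Lemma real_part_le (z w : F) : z <= w -> real_part z <= real_part w.
Proof.
by rewrite /real_part; case: k z w => //= -[? ?] [? ?]; rewrite lecE => /andP[].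
Qed.

Lemma real_part0 : real_part (0 : F) = 0.
Proof. by rewrite /real_part; case: k. Qed.

Lemma real_part_of_real t : real_part (of_real t) = t.
Proof. by rewrite /real_part /of_real; case: k. Qed.

Lemma real_partK (z : F) : 0 <= z -> of_real (real_part z) = z.
Proof.
rewrite /real_part /of_real; case: k z => //= -[x y].
by rewrite lecE /= => /andP[/eqP ->].
Qed.

Lemma real_part_mull t (z : F) : real_part (of_real t * z) = t * real_part z.
Proof.
rewrite /real_part /of_real; case: k z => //= -[x y] /=.
by rewrite mul0r subr0.
Qed.

Lemma normr_of_real t : `|of_real t| = of_real `|t| :> F.
Proof.
by rewrite /of_real; case: k => //=; rewrite normc_def /= expr0n addr0 sqrtr_sqr.
Qed.

Lemma nrm_ge0 (X : normedModType F) (x : X) : 0 <= nrm x.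
Proof. by rewrite /nrm -real_part0 real_part_le. Qed.

Lemma nrmD (X : normedModType F) (x y : X) : nrm (x + y) <= nrm x + nrm y.
Proof. by rewrite /nrm -real_partD real_part_le // ler_normD. Qed.

Lemma nrmZ (X : normedModType F) a (x : X) : nrm (a *: x) = absv a * nrm x.
Proof.
rewrite /nrm /absv normrZ -[X in real_part (X * _)]real_partK //.
by rewrite real_part_mull.
Qed.

Lemma nrm0 (X : normedModType F) : nrm (0 : X) = 0.
Proof. by rewrite /nrm normr0 real_part0. Qed.

Lemma nrmN (X : normedModType F) (x : X) : nrm (- x) = nrm x.
Proof. by rewrite /nrm normrN. Qed.

Lemma nrmB (X : normedModType F) (x y : X) : nrm x - nrm y <= nrm (x - y).
Proof. by rewrite lerBlDr; apply: le_trans (nrmD _ _); rewrite subrK. Qed.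

Lemma nrm_sum (X : normedModType F) (I : Type) (r : seq I) (P : pred I)
  (x : I -> X) : nrm (\sum_(i <- r | P i) x i) <= \sum_(i <- r | P i) nrm (x i).
Proof.
elim/big_ind2: _ => [|? ? ? ? h1 h2|//]; first by rewrite nrm0.
by apply: le_trans (nrmD _ _) _; exact: lerD.
Qed.

Lemma nrmMn (X : normedModType F) (x : X) n : nrm (x *+ n) = nrm x *+ n.
Proof.
rewrite /nrm normrMn; elim: n => [|n IH]; first exact: real_part0.
by rewrite !mulrS real_partD IH.
Qed.

Lemma absv_ge0 (a : F) : 0 <= absv a.
Proof. by rewrite /absv -real_part0 real_part_le. Qed.

Lemma absvM (a b : F) : absv (a * b) = absv a * absv b.
Proof.
by rewrite /absv normrM -[X in real_part (X * _)]real_partK // real_part_mull.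
Qed.

Lemma absv_of_real t : absv (of_real t) = `|t|.
Proof. by rewrite /absv normr_of_real real_part_of_real. Qed.

Lemma absv0 : absv (0 : F) = 0.
Proof. by rewrite /absv normr0 real_part0. Qed.

Lemma absv1 : absv (1 : F) = 1.
Proof. by rewrite /absv normr1 /real_part; case: k. Qed.

Lemma absv_eq0 (a : F) : absv a = 0 -> a = 0.
Proof.
move=> a0; apply/eqP; rewrite -normr_eq0 -[`|a|]real_partK // -/(absv a) a0.
by rewrite /of_real; case: k.
Qed.

End Scalars.

Section LpNorm.
Variables (R : realType) (k : scalar_kind).
Local Notation F := (scal R k).
Implicit Types (p : \bar R) (a b : nat -> F).

(** The l_p norm on pairs of non-negative numbers; it computes the norm of a
    concatenation from the norms of the two parts. *)
Definition lpadd p (x y : R) : R :=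
  match p with
  | r%:E => (x `^ r + y `^ r) `^ r^-1
  | +oo%E => Num.max x y
  | -oo%E => 0
  end.

Lemma lpnorm_ge0 p n a : 0 <= lpnorm p n a.
Proof.
case: p => [r| |] //=; first exact: powR_ge0.
by elim/big_ind: _ => [|x y x0 _|i _]; rewrite ?absv_ge0 ?le_max ?x0.
Qed.

Lemma eq_lpnorm p n a b : (forall i, (i < n)%N -> a i = b i) ->
  lpnorm p n a = lpnorm p n b.
Proof.
by move=> ab; case: p => [r| |] //=; [congr (_ `^ _)|]; apply: eq_bigr => i _;
  rewrite ab.
Qed.

Lemma lpnorm_cat p m n a : (1 <= p)%E -> lpnorm p (m + n) a =
  lpadd p (lpnorm p m a) (lpnorm p n (fun i => a (m + i)%N)).
Proof.
case: p => [r| |] //= r1.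
  have r0 : r != 0 by rewrite gt_eqF // (lt_le_trans ltr01) // -lee_fin.
  rewrite big_split_ord /= -!powRrM mulVf // !powRr1 //;
    by apply: sumr_ge0 => i _; exact: powR_ge0.
set f := fun i : 'I_(m + n) => absv (a i).
apply/le_anti/andP; split.
  apply: bigmax_le => [|i _]; first by rewrite le_max (lpnorm_ge0 +oo%E m a).
  case: (split_ordP i) => j ->; rewrite le_max; apply/orP; [left|right].
    exact: (le_bigmax _ (fun i : 'I_m => absv (a i))).
  exact: (le_bigmax _ (fun i : 'I_n => absv (a (m + i)%N))).
rewrite ge_max; apply/andP; split.
  apply: bigmax_le => [|i _]; first exact: (lpnorm_ge0 +oo%E (m + n) a).
  exact: (le_bigmax _ f (lshift n i)).
apply: bigmax_le => [|i _]; first exact: (lpnorm_ge0 +oo%E (m + n) a).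
exact: (le_bigmax _ f (rshift m i)).
Qed.

Lemma lpnormZ p n t a : (1 <= p)%E ->
  lpnorm p n (fun i => t * a i) = absv t * lpnorm p n a.
Proof.
case: p => [r| |] //= r1.
- have r0 : r != 0 by rewrite gt_eqF // (lt_le_trans ltr01) // -lee_fin.
  under eq_bigr do rewrite absvM powRM ?absv_ge0 //.
  rewrite -mulr_sumr powRM ?powR_ge0 //; last first.
    by apply: sumr_ge0 => i _; exact: powR_ge0.
  by rewrite -powRrM mulfV // powRr1 ?absv_ge0.
- elim/big_ind2: _ => [|? x ? y -> ->|i _]; rewrite ?mulr0 ?absvM //.
  by rewrite maxr_pMr // absv_ge0.
Qed.

Lemma lpnorm1 p a : (1 <= p)%E -> lpnorm p 1 a = absv (a 0%N).
Proof.
case: p => [r| |] //= r1; rewrite big_ord_recl big_ord0 /=; last first.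
  by rewrite /Num.max; case: ltgtP (absv_ge0 (a 0%N)).
have r0 : r != 0 by rewrite gt_eqF // (lt_le_trans ltr01) // -lee_fin.
by rewrite addr0 -powRrM mulfV // powRr1 ?absv_ge0.
Qed.

Lemma lpnorm0 p n a : (1 <= p)%E -> (forall i, (i < n)%N -> a i = 0) ->
  lpnorm p n a = 0.
Proof.
move=> p1 a0; rewrite (@eq_lpnorm _ _ _ (fun i => 0 * a i)) => [|i i_n].
  by rewrite lpnormZ // absv0 mul0r.
by rewrite mul0r a0.
Qed.

Lemma lpaddx0 p x : (1 <= p)%E -> 0 <= x -> lpadd p x 0 = x.
Proof.
case: p => [r| |] //= r1 x0; last by rewrite /Num.max; case: ltgtP x0.
have r0 : r != 0 by rewrite gt_eqF // (lt_le_trans ltr01) // -lee_fin.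
by rewrite powR0 // addr0 -powRrM mulfV // powRr1.
Qed.

Lemma lpadd0x p x : (1 <= p)%E -> 0 <= x -> lpadd p 0 x = x.
Proof.
move=> p1 x0; rewrite -[RHS](lpaddx0 p1 x0).
case: p p1 => [r| |] _; rewrite /lpadd; last by [].
  by rewrite [in LHS]addrC.
by rewrite maxC.
Qed.

Lemma absv_le_lpnorm p n a i : (1 <= p)%E -> (i < n)%N ->
  absv (a i) <= lpnorm p n a.
Proof.
case: p => [r| |] //= r1 i_n; last first.
  exact: (le_bigmax _ (fun i : 'I_n => absv (a i)) (Ordinal i_n)).
have r0 : 0 < r by rewrite (lt_le_trans ltr01) // -lee_fin.
rewrite -[X in X <= _]powRr1 ?absv_ge0 // -(@mulfV _ r) ?gt_eqF // powRrM.
apply: ge0_ler_powR; rewrite ?nnegrE ?powR_ge0 ?invr_ge0 ?(ltW r0) //.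
  by apply: sumr_ge0 => j _; exact: powR_ge0.
rewrite (bigD1 (Ordinal i_n)) //= lerDl.
by apply: sumr_ge0 => j _; exact: powR_ge0.
Qed.

Lemma lpnorm_delta p n j : (1 <= p)%E -> (j < n)%N ->
  lpnorm p n (fun i => (i == j)%:R : F) = 1.
Proof.
move=> p1 jn; rewrite -(subnKC jn) -addn1 lpnorm_cat // lpnorm_cat // addn1.
rewrite lpnorm1 // addn0 eqxx absv1 lpnorm0 // => [|i ij].
  rewrite lpnorm0 // => [|i _]; last first.
    by rewrite addSn -addnS -{2}[j]addn0 eqn_add2l.
  rewrite lpaddx0 //; case: p p1 => [r| |] //= r1.
    have r0 : r != 0 by rewrite gt_eqF // (lt_le_trans ltr01) // -lee_fin.
    by rewrite powR0 // powR1 add0r powR1.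
  by rewrite /Num.max ltr01.
by rewrite ltn_eqF.
Qed.

Lemma lpnorm_l1 n a : lpnorm 1%:E n a = \sum_(i < n) absv (a i).
Proof.
rewrite /= invr1 powRr1; last by apply: sumr_ge0 => j _; exact: powR_ge0.
by apply: eq_bigr => i _; rewrite powRr1 ?absv_ge0.
Qed.

Definition catf m b a : nat -> F :=
  fun i => if (i < m)%N then b i else a (i - m)%N.

Lemma catf_lt m b a i : (i < m)%N -> catf m b a i = b i.
Proof. by rewrite /catf => ->. Qed.

Lemma catf_add m b a i : catf m b a (m + i) = a i.
Proof. by rewrite /catf ltnNge leq_addr addKn. Qed.

Lemma lpnorm_catf p m n b a : (1 <= p)%E ->
  lpnorm p (m + n) (catf m b a) = lpadd p (lpnorm p m b) (lpnorm p n a).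
Proof.
move=> p1; rewrite lpnorm_cat //; congr lpadd; apply: eq_lpnorm => i i_m.
  exact: catf_lt.
exact: catf_add.
Qed.

End LpNorm.

Section LinearCombinations.
Variables (R : realType) (k : scalar_kind) (X : completeNormedModType (scal R k)).
Local Notation F := (scal R k).
Implicit Types (p : \bar R) (a b : nat -> F) (s v z : seq X).

Definition lc s a : X := \sum_(i < size s) a i *: s`_i.

Lemma lc_cat s v a : lc (s ++ v) a = lc s a + lc v (fun i => a (size s + i)%N).
Proof.
rewrite /lc size_cat big_split_ord /=; congr (_ + _); apply: eq_bigr => i _.
  by rewrite nth_cat ltn_ord.
by rewrite nth_cat ltnNge leq_addr addKn.
Qed.

Lemma eq_lc s a b : (forall i, (i < size s)%N -> a i = b i) -> lc s a = lc s b.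
Proof. by move=> ab; apply: eq_bigr => i _; rewrite ab. Qed.

Lemma lcZ s t a : lc s (fun i => t * a i) = t *: lc s a.
Proof. by rewrite /lc scaler_sumr; apply: eq_bigr => i _; rewrite scalerA. Qed.

Lemma lcB s a b : lc s (fun i => a i - b i) = lc s a - lc s b.
Proof. by rewrite /lc -sumrB; apply: eq_bigr => i _; rewrite scalerBl. Qed.

Lemma lc_catf s v b a : lc (s ++ v) (catf (size s) b a) = lc s b + lc v a.
Proof.
rewrite lc_cat; congr (_ + _); apply: eq_lc => i i_s; first exact: catf_lt.
exact: catf_add.
Qed.

Lemma lc_rcons s x a : lc (rcons s x) a = lc s a + a (size s) *: x.
Proof. by rewrite -cats1 lc_cat /lc big_ord1 addn0. Qed.

Lemma lc_zero s a : (forall i, (i < size s)%N -> a i = 0) -> lc s a = 0.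
Proof. by move=> a0; rewrite /lc big1 // => i _; rewrite a0 ?scale0r. Qed.

Lemma lc_delta s j : (j < size s)%N -> lc s (fun i => (i == j)%:R) = s`_j.
Proof.
move=> js; rewrite /lc (bigD1 (Ordinal js)) //= eqxx scale1r big1 ?addr0 // => i.
by rewrite -val_eqE /= => /negPf ->; rewrite scale0r.
Qed.

(** The property of a sequence z of successive normalized l_p blocks of s that
    transports upper and lower l_p estimates from s to z.  Subsequences of s
    have it too. *)
Definition block p z s : Prop := forall a, exists b,
  lc z a = lc s b /\ lpnorm p (size z) a = lpnorm p (size s) b.

Lemma block_nil p s : (1 <= p)%E -> block p [::] s.
Proof.
move=> p1 a; exists (fun=> 0); rewrite lc_zero // lc_zero //.
by rewrite !lpnorm0.
Qed.

Lemma block_rcons p z s v a : (1 <= p)%E -> block p z s ->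
  lpnorm p (size v) a = 1 -> block p (rcons z (lc v a)) (s ++ v).
Proof.
move=> p1 zs a1 c; have [b [zb nb]] := zs c.
exists (catf (size s) b (fun i => c (size z) * a i)).
rewrite lc_catf lc_rcons zb lcZ; split=> //.
rewrite size_cat size_rcons lpnorm_catf // -addn1 lpnorm_cat // nb lpnorm1 //.
by rewrite addn0 lpnormZ // a1 mulr1.
Qed.

Lemma block_cat p z s v : (1 <= p)%E -> block p z s -> block p z (s ++ v).
Proof.
move=> p1 zs a; have [b [zb nb]] := zs a.
exists (catf (size s) b (fun=> 0)); rewrite lc_catf [lc v _]lc_zero // addr0.
rewrite size_cat lpnorm_catf // [X in lpadd _ _ X]lpnorm0 //.
by rewrite lpaddx0 ?lpnorm_ge0.
Qed.

Lemma block_filter p (c : pred X) s : (1 <= p)%E -> block p (seq.filter c s) s.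
Proof.
move=> p1; elim/last_ind: s => [|s x IH]; first exact: block_nil.
rewrite filter_rcons -[in X in block _ _ X]cats1.
case: (c x); last exact: block_cat.
have xE : lc [:: x] (fun=> 1) = x by rewrite /lc big_ord1 scale1r.
rewrite -[X in rcons _ X]xE; apply: block_rcons => //.
by rewrite lpnorm1 // absv1.
Qed.

End LinearCombinations.

(** * The trees of an operator *)

Section OperatorTrees.
Variables (R : realType) (k : scalar_kind).
Local Notation F := (scal R k).
Local Notation banach := (completeNormedModType F).
Implicit Types (X Y Z W : banach) (p : \bar R) (K : R) (c : nat -> F).

Definition upper_p p X (s : seq X) : Prop :=
  forall c, nrm (lc s c) <= lpnorm p (size s) c.

Definition lower_p p X Y (A : X -> Y) K (s : seq X) : Prop :=
  forall c, lpnorm p (size s) c <= K * nrm (A (lc s c)).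

Lemma upper_catr p X (s v : seq X) : (1 <= p)%E ->
  upper_p p (s ++ v) -> upper_p p v.
Proof.
move=> p1 up c; have := up (catf (size s) (fun=> 0) c).
rewrite lc_catf [lc s _]lc_zero // add0r size_cat lpnorm_catf //.
by rewrite [X in lpadd _ X]lpnorm0 // lpadd0x // lpnorm_ge0.
Qed.

Lemma upper_block p X (z s : seq X) : block p z s -> upper_p p s -> upper_p p z.
Proof. by move=> zs up c; have [b [-> ->]] := zs c. Qed.

Lemma lower_block p X Y (A : X -> Y) K (z s : seq X) :
  block p z s -> lower_p p A K s -> lower_p p A K z.
Proof. by move=> zs lo c; have [b [-> ->]] := zs c. Qed.

Lemma block_catl p X (s v : seq X) : (1 <= p)%E -> block p s (s ++ v).
Proof. by move=> p1; apply: block_cat => // a; exists a. Qed.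

Lemma lc_map X Y (f : X -> Y) (s : seq X) c : linear f ->
  lc [seq f x | x <- s] c = f (lc s c).
Proof.
move=> linf; elim/last_ind: s => [|s x IH].
  rewrite /lc !big_ord0; have := linf (-1) 0 0.
  by rewrite !scaler0 addr0 scaleN1r addNr => ->.
by rewrite map_rcons !lc_rcons size_map IH addrC -linf addrC.
Qed.

Lemma TpP p X Y (A : operator X Y) K (s : seq X) : (1 <= p)%E ->
  Tp p A K s <-> upper_p p s /\ lower_p p A K s.
Proof.
move=> p1; split=> [[_ up lo]|[up lo]]; split.
- by move=> c; have := up c; rewrite mul1r.
- by move=> c; have := lo c; rewrite /lcnorm -/(lc _ c) lc_map //; exact: linearP.
- move=> x /(nthP 0)[j js <-]; rewrite /unit_ball/= -lc_delta //.
  by apply: le_trans (up _) _; rewrite lpnorm_delta.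
- by move=> c; rewrite mul1r; exact: up.
- by move=> c; rewrite /lcnorm -/(lc _ c) lc_map; [exact: lo|exact: linearP].
Qed.

Lemma is_tree_Tp p X Y (A : operator X Y) K : (1 <= p)%E -> is_tree (Tp p A K).
Proof.
move=> p1 s v /(TpP _ _ _ p1)[up lo]; apply/(TpP _ _ _ p1).
have sv : block p s (s ++ v) by exact: block_catl.
by split; [exact: upper_block sv up|exact: lower_block sv lo].
Qed.

(** An order is at most omega ^ xi exactly when the derived tree of order
    omega ^ xi is empty, which takes care of the infinite value and of the
    supremum over K.  From here on only the emptiness of derived trees matters,
    and it is tested at the empty sequence. *)
Lemma NPclassP p X Y (A : operator X Y) xi : (1 <= p)%E ->
  NPclass p xi A <->
  forall K, 1 <= K -> ~ derived (Tp p A K) (opow xi) [::].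
Proof.
move=> p1.
have empty K : ~ derived (Tp p A K) (opow xi) [::] <->
    derived (Tp p A K) (opow xi) = set0.
  split=> [D0|-> //]; apply/seteqP; split=> // s Ds; apply: D0.
  exact: (is_tree_derived (is_tree_Tp p1) (s := [::])) Ds.
rewrite /NPclass /NP /eolub; split.
  case: asboolP => // no /= NPxi K K1; apply/empty.
  have [[r rE]|To] :=
      pselect (exists r, tree_order (Tp p A K) = Some r); last first.
    case: no; exists (exist _ K K1) => /=; case E: (tree_order _) => [r|] //.
    by case: To; exists r.
  have := ole_trans (olub_ub _ (exist _ K K1)) NPxi; rewrite /= rE /= => rxi.
  suff r0 : derived (Tp p A K) r = set0.
    apply/seteqP; split=> // s Ds; rewrite -r0; exact: derived_anti rxi _ Ds.
  move: rE; rewrite /tree_order; case: pselect => // h [<-].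
  by case: cid => ? [].
move=> D0; case: asboolP => [[[K K1]] /=|_ /=].
  by have /empty/tree_orderP[r ->] := D0 K K1.
apply: olub_least => -[K K1] /=.
by have /empty D := D0 K K1; have [r -> [_ /(_ _ D)]] := tree_orderP D.
Qed.

Lemma bounded_ge1 X Y (A : operator X Y) :
  exists2 M : R, 1 <= M & forall x, nrm (A x) <= M * nrm x.
Proof.
have [M AM] := op_bounded A; exists (Num.max 1 M); first by rewrite le_max lexx.
move=> x; apply: le_trans (AM x) _.
by rewrite ler_wpM2r ?nrm_ge0 // le_max lexx orbT.
Qed.

(** A sequence (w_i) is sent to (B w_i / b), where b >= 1 bounds the norm of B,
    so as to preserve the upper estimate. *)
Lemma derived_compose p W X Y Z (B : operator W X) (A : operator X Y)
    (D : operator Y Z) (P : operator W Z) : (1 <= p)%E ->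
  (forall w, P w = D (A (B w))) ->
  exists2 M : R, 1 <= M & forall K a, 1 <= K ->
    derived (Tp p P K) a [::] -> derived (Tp p A (K * M)) a [::].
Proof.
move=> p1 PE; have [b b1 Bb] := bounded_ge1 B; have [d d1 Dd] := bounded_ge1 D.
have b0 : 0 < b := lt_le_trans ltr01 b1.
exists (d * b) => [|K a K1]; first by rewrite mulr_ege1.
pose g w : X := of_real k b^-1 *: B w.
have ling : linear g.
  by move=> t x y; rewrite /g linearP scalerDr !scalerA mulrC.
have gE w : nrm (g w) = b^-1 * nrm (B w).
  by rewrite nrmZ absv_of_real ger0_norm // invr_ge0 ltW.
apply: (derived_simulation (rel := fun s u => u = [seq g w | w <- s])) => //.
- exact: is_tree_Tp.
- exact: is_tree_Tp.
- move=> s u /(TpP _ _ _ p1)[up lo] ->; apply/(TpP _ _ _ p1).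
  split=> c; rewrite lc_map // size_map.
    by apply: le_trans (up c); rewrite gE ler_pdivrMl.
  apply: le_trans (lo c) _; rewrite PE -mulrA ler_pM2l ?(lt_le_trans ltr01) //.
  apply: le_trans (Dd _) _; rewrite -mulrA ler_pM2l ?(lt_le_trans ltr01) //.
  rewrite /g linearZ nrmZ absv_of_real ger0_norm ?invr_ge0 ?(ltW b0) //.
  by rewrite mulrA divff ?mul1r ?gt_eqF.
- by move=> s u x _ ->; exists (g x); rewrite map_rcons.
Qed.

Lemma derived_perturb p X Y (A B : operator X Y) K a : (1 <= p)%E -> 0 < K ->
  (forall x, nrm (A x) <= nrm (B x) + (2 * K)^-1 * nrm x) ->
  derived (Tp p A K) a [::] -> derived (Tp p B (2 * K)) a [::].
Proof.
move=> p1 K0 AB.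
apply: (derived_simulation (rel := fun s u => u = s)) => //.
- exact: is_tree_Tp.
- exact: is_tree_Tp.
- move=> s u /(TpP _ _ _ p1)[up lo] ->; apply/(TpP _ _ _ p1); split=> // c.
  have h1 := lo c; have h2 := AB (lc s c); have h3 := up c.
  have h4 : K * nrm (A (lc s c)) <=
      K * nrm (B (lc s c)) + 2^-1 * lpnorm p (size s) c.
    apply: le_trans (_ : K * (nrm (B (lc s c)) + (2 * K)^-1 * nrm (lc s c)) <= _).
      by rewrite ler_pM2l.
    rewrite mulrDr lerD2l mulrA invfM mulrCA mulfV ?gt_eqF // mulr1.
    by rewrite ler_pM2l // invr_gt0.
  by lra.
- by move=> s u x _ ->; exists x.
Qed.

Lemma opnorm_bound X Y (A B : operator X Y) x :
  nrm (A x - B x) <= opnorm (fun x => A x - B x) * nrm x.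
Proof.
have [x0|x_neq0] := eqVneq (nrm x) 0.
  have -> : x = 0.
    apply/eqP; rewrite -normr_eq0 -[`|x|]real_partK // -/(nrm x) x0.
    by rewrite /of_real; case: k.
  by rewrite !linear0 ?addr0 ?subrr !nrm0 mulr0.
have nx : 0 < nrm x by rewrite lt_neqAle eq_sym x_neq0 nrm_ge0.
have [a a1 Aa] := bounded_ge1 A; have [b b1 Bb] := bounded_ge1 B.
rewrite -ler_pdivrMr // mulrC.
rewrite -[X in X * _]ger0_norm ?invr_ge0 ?nrm_ge0 // -(absv_of_real k) -nrmZ.
rewrite scalerBr -!linearZ; apply: ub_le_sup.
  exists (a + b) => _ [y y1 <-]; apply: le_trans (nrmD _ _) _; rewrite nrmN.
  have ball t (T : operator X Y) :
      1 <= t -> (forall x, nrm (T x) <= t * nrm x) -> nrm (T y) <= t.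
    move=> t1 Tt; apply: le_trans (Tt y) _.
    by rewrite -[leRHS]mulr1 ler_pM2l // (lt_le_trans ltr01).
  by apply: lerD; [exact: (ball _ A)|exact: (ball _ B)].
exists (of_real k (nrm x)^-1 *: x) => //.
by rewrite /unit_ball /= nrmZ absv_of_real ger0_norm ?invr_ge0 ?nrm_ge0 // mulVf.
Qed.

Lemma closed_NPclass p xi : (1 <= p)%E -> closed_class (@NPclass R k p xi).
Proof.
move=> p1 X Y A approx; apply/NPclassP => // K K1.
have K0 : 0 < K := lt_le_trans ltr01 K1.
have [|B [/(NPclassP _ _ p1) BC AB]] := approx (2 * K)^-1.
  by rewrite invr_gt0 mulr_gt0.
apply: contra_not (BC (2 * K) _); last by lra.
apply: derived_perturb => // x.
have := opnorm_bound A B x; have := nrmB (A x) (B x); have := nrm_ge0 x.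
move: AB; set e := opnorm _; set d := (_)^-1; move=> ed x0.
have : e * nrm x <= d * nrm x by rewrite ler_wpM2r // ltW.
by lra.
Qed.

End OperatorTrees.

(** * Finite rank operators and sums of operators *)

Section Sums.
Variables (R : realType) (k : scalar_kind).
Local Notation F := (scal R k).
Local Notation banach := (completeNormedModType F).
Implicit Types (X Y Z W : banach) (p : \bar R) (K : R) (c : nat -> F).

(** A sequence longer than a spanning sequence of the range has a nontrivial
    linear combination that A maps to 0, against the lower estimate. *)
Lemma finite_rank_size p X Y (A : operator X Y) : (1 <= p)%E ->
  finite_rank A -> exists n, forall K s, Tp p A K s -> (size s <= n)%N.
Proof.
move=> p1 [r /choice[f Af]]; exists (size r) => K s /(TpP _ _ _ p1)[_ lo].
rewrite leqNgt; apply/negP => rs.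
pose M : 'M[F]_(size s, size r) := \matrix_(i, j) f s`_i j.
have : kermx M != 0.
  rewrite -mxrank_eq0 mxrank_ker subn_eq0 -ltnNge.
  exact: leq_ltn_trans (rank_leq_col _) rs.
move=> /rowV0Pn[w /sub_kermxP wM w0].
pose c i : F := if insub i is Some j then w 0 j else 0.
have cE (i : 'I_(size s)) : c i = w 0 i by rewrite /c valK.
have Ac : A (lc s c) = 0.
  have -> : A (lc s c) =
      \sum_(i < size s) \sum_(j < size r) (w 0 i * M i j) *: r`_j.
    rewrite /lc linear_sum; apply: eq_bigr => i _.
    rewrite linearZ_LR Af scaler_sumr; apply: eq_bigr => j _.
    by rewrite scalerA cE mxE.
  rewrite exchange_big big1 //= => j _; rewrite -scaler_suml.
  by have /rowP/(_ j) := wM; rewrite !mxE => ->; rewrite scale0r.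
case/eqP: w0; apply/rowP => i; rewrite mxE -cE; apply: absv_eq0.
apply/le_anti; rewrite absv_ge0 andbT.
by apply: le_trans (absv_le_lpnorm _ p1 (ltn_ord i)) (le_trans (lo c) _);
  rewrite Ac nrm0 mulr0.
Qed.

Lemma finite_rank_NPclass p X Y (A : operator X Y) xi : (1 <= p)%E ->
  ole oone xi -> finite_rank A -> NPclass p xi A.
Proof.
move=> p1 xi1 /(finite_rank_size p1)[n An]; apply/(NPclassP _ _ p1) => K _.
have nxi : ole (onat n.+1) (opow xi).
  apply: ole_trans (opow_mono xi1); exact/oltW/onat_lt_opow_oone.
move=> /(derived_anti nxi)/(derived_onat (is_tree_Tp p1))[v vn /An].
by rewrite /= vn ltnn.
Qed.

(** The vectors chosen in the outer tree are normalized blocks u_j with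
    |A u_j| <= eps_j.  The predicate [P d n] keeps track of the number n of
    blocks already chosen when the order d is still to be used.  Taking it
    trivial treats infinite b; for finite b it bounds n, so that the smallness
    of the eps_j is required only for that many blocks. *)
Lemma derived_sum p X Y (A B S : operator X Y) K C (eps : nat -> R)
    (P : Ord -> nat -> Prop) a b : (1 <= p)%E -> 0 < K -> 0 < C ->
  (forall x, nrm (S x) <= C * nrm (A x) + nrm (B x)) ->
  (forall n, 0 < eps n) ->
  (forall d n c, P d n ->
    C * (\sum_(j < n) absv (c j) * eps j) <= (2 * K)^-1 * lpnorm p n c) ->
  (forall e d n, olt e d -> P d n ->
    P e n.+1 /\ ~ derived (Tp p A (eps n)^-1) a [::]) ->
  P b 0%N ->
  derived (Tp p S K) (omul a b) [::] -> derived (Tp p B (2 * K)) b [::].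
Proof.
move=> p1 K0 C0 SAB eps0 Peps Pstep P0.
apply: (derived_thinning (rel := fun d s u => [/\ block p u s,
  forall j, (j < size u)%N -> nrm (A u`_j) <= eps j & P d (size u)])).
- exact: is_tree_Tp.
- exact: is_tree_Tp.
- move=> d s u /(TpP _ _ _ p1)[up lo] [us Au Pu]; apply/(TpP _ _ _ p1).
  split=> [|c]; first exact: upper_block us up.
  have lou := lower_block us lo c.
  have hA : C * nrm (A (lc u c)) <= (2 * K)^-1 * lpnorm p (size u) c.
    apply: le_trans (Peps _ _ _ Pu); rewrite ler_pM2l // /lc linear_sum.
    apply: le_trans (nrm_sum _ _ _) _; apply: ler_sum => j _.
    by rewrite linearZ nrmZ ler_wpM2l ?absv_ge0 // Au.
  have hK : K * ((2 * K)^-1 * lpnorm p (size u) c) = 2^-1 * lpnorm p (size u) c.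
    by rewrite mulrA invfM mulrCA mulfV ?gt_eqF // mulr1.
  have : K * nrm (S (lc u c)) <= K * (C * nrm (A (lc u c)) + nrm (B (lc u c))).
    by rewrite ler_pM2l.
  have : K * (C * nrm (A (lc u c))) <= K * ((2 * K)^-1 * lpnorm p (size u) c).
    by rewrite ler_pM2l.
  by rewrite hK; lra.
- move=> e d s u U ed [us Au Pu] treeU US Ds.
  have [Pe noA] := Pstep _ _ _ ed Pu.
  apply: contrapT => none; apply: noA.
  (* Without a small block in U beyond s, all the continuations of s in U
     satisfy the lower estimate of T_p(A, 1/eps). *)
  have big v c : U (s ++ v) -> lpnorm p (size v) c = 1 ->
      eps (size u) < nrm (A (lc v c)).
    move=> Uv c1; rewrite ltNge; apply/negP => small; apply: none.
    exists (s ++ v), (lc v c); split=> //; split.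
    - exact: block_rcons.
    - move=> j; rewrite size_rcons ltnS nth_rcons.
      by case: ltngtP => // [/Au//|->].
    - by rewrite size_rcons.
  apply: (derived_simulation (rel := fun t v => t = s ++ v)) Ds => //.
  + exact: is_tree_Tp.
  + move=> t v Uv tE; rewrite {}tE in Uv; apply/(TpP _ _ _ p1).
    split=> [|c].
      by have /US/(TpP _ _ _ p1)[up _] := Uv; exact: upper_catr up.
    have [->|c_neq0] := eqVneq (lpnorm p (size v) c) 0.
      by rewrite mulr_ge0 ?nrm_ge0 // invr_ge0 ltW.
    have c0 : 0 < lpnorm p (size v) c.
      by rewrite lt_neqAle eq_sym c_neq0 lpnorm_ge0.
    have := big v (fun i => of_real k (lpnorm p (size v) c)^-1 * c i) Uv.
    rewrite lpnormZ // absv_of_real ger0_norm ?invr_ge0 ?(ltW c0) // mulVf //.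
    rewrite lcZ linearZ nrmZ absv_of_real ger0_norm ?invr_ge0 ?(ltW c0) //.
    move=> /(_ erefl); rewrite ltr_pdivlMl // => /ltW.
    by rewrite mulrC ler_pdivlMl.
  + by move=> t v x _ ->; exists x; rewrite rcons_cat.
  + by rewrite cats0.
- split=> //; exact: block_nil.
Qed.

End Sums.

(** * Choosing the next vector of a basic sequence *)

Section C0.
Variables (R : realType) (k : scalar_kind).
Local Notation F := (scal R k).
Local Notation banach := (completeNormedModType F).
Implicit Types (X Y : banach) (K M : R) (c : nat -> F).

(** Compactness of the box of coefficients in the form of a finite colouring
    whose classes have small diameter, which suits the pigeonhole principle. *)
Lemma real_code M rho : 0 < rho -> exists (I : finType) (code : R -> I),
  forall x y, `|x| <= M -> `|y| <= M -> code x = code y -> `|x - y| <= rho.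
Proof.
move=> rho0; pose t x := Num.truncn ((x + M) / rho).
exists 'I_(Num.truncn ((M + M) / rho)).+1, (fun x => inord (t x)).
have tP x : `|x| <= M -> (t x)%:R * rho <= x + M < (t x).+1%:R * rho.
  move=> /ler_normlP[xM _]; rewrite -ler_pdivlMr // -ltr_pdivrMr //.
  by apply: truncn_itv; rewrite divr_ge0 ?(ltW rho0) //; lra.
have tb x : `|x| <= M -> (t x < (Num.truncn ((M + M) / rho)).+1)%N.
  move=> /ler_normlP[_ xM]; rewrite ltnS; apply: le_truncn.
  by rewrite ler_pM2r ?invr_gt0 // lerD2r.
move=> x y xM yM /(congr1 val); rewrite /= !inordK ?tb // => txy.
have := tP x xM; have := tP y yM; rewrite -txy -natr1 mulrDl mul1r.
move=> /andP[y1 y2] /andP[x1 x2]; apply/ler_normlP; split; lra.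
Qed.

Lemma scal_code M rho : 0 < rho -> exists (I : finType) (code : F -> I),
  forall x y, absv x <= M -> absv y <= M -> code x = code y ->
    absv (x - y) <= rho.
Proof.
rewrite /absv /real_part; case: k => /= rho0; first exact: real_code.
have [|I [code codeP]] := @real_code M (rho / 2); first by rewrite divr_gt0.
exists (I * I)%type, (fun z => (code (complex.Re z), code (complex.Im z))).
move=> [x1 x2] [y1 y2] /=.
have le_normc (a b : R) : `|a| <= Num.sqrt (a ^+ 2 + b ^+ 2).
  by rewrite -sqrtr_sqr ler_wsqrtr // lerDl sqr_ge0.
have normc_le (a b : R) : Num.sqrt (a ^+ 2 + b ^+ 2) <= `|a| + `|b|.
  rewrite -[leRHS]ger0_norm ?addr_ge0 // -sqrtr_sqr ler_wsqrtr //.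
  rewrite sqrrD !real_normK ?num_real // lerD2r lerDl.
  by rewrite mulrn_wge0 // mulr_ge0.
move=> xM yM [xy1 xy2]; apply: le_trans (normc_le _ _) _.
rewrite [rho]splitr; apply: lerD; apply: codeP => //.
- exact: le_trans (le_normc _ _) xM.
- exact: le_trans (le_normc _ _) yM.
- by apply: le_trans xM; rewrite addrC; exact: le_normc.
- by apply: le_trans yM; rewrite addrC; exact: le_normc.
Qed.

Lemma box_code n M rho : 0 < rho ->
  exists (I : finType) (code : (nat -> F) -> I), forall b c,
    (forall i, (i < n)%N -> absv (b i) <= M) ->
    (forall i, (i < n)%N -> absv (c i) <= M) ->
    code b = code c -> forall i, (i < n)%N -> absv (b i - c i) <= rho.
Proof.
move=> rho0; have [I [code codeP]] := scal_code M rho0.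
exists {ffun 'I_n -> I}, (fun b => [ffun i : 'I_n => code (b i)]).
move=> b c bM cM bc i i_n; apply: codeP; [exact: bM|exact: cM|].
by have /ffunP/(_ (Ordinal i_n)) := bc; rewrite !ffunE.
Qed.

Lemma large_fiber n m (I : finType) (f : 'I_n -> I) : (#|I| * m < n)%N ->
  exists i, (m < #|[pred j | f j == i]|)%N.
Proof.
move=> Imn; apply: contrapT => small; move: Imn; apply/negP; rewrite -leqNgt.
rewrite -[leqLHS]card_ord -sum1_card (partition_big f xpredT) //=.
rewrite -sum_nat_const; apply: leq_sum => i _.
by rewrite sum1_card leqNgt; apply/negP => mi; apply: small; exists i.
Qed.

(** The vector x extends the basic sequence (A u_i) with a loss eta > 1.
    Otherwise each vector v_j of a long sequence comes with a unit vector e_j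
    in the span of the A u_i and a scalar t_j such that
    |e_j + t_j A v_j| <= 1 / eta.  That span is finite dimensional, so by the
    pigeonhole principle many of the e_j are close to one vector e.
    Averaging over these j, the mean of the t_j A v_j tends to 0 by the upper
    c_0 estimate on v, which leaves |e| < 1. *)
Lemma next_basic X Y (A : operator X Y) (d eta M : R) n : 0 < d -> 1 < eta ->
  exists N, forall u v : seq X, size u = n ->
    upper_p +oo u -> upper_p +oo v ->
    (forall c i, (i < n)%N -> absv (c i) <= M * nrm (A (lc u c))) ->
    (forall x, x \in v -> d <= nrm (A x)) -> (N < size v)%N ->
    exists2 x, x \in v &
      forall c t, nrm (A (lc u c)) <= eta * nrm (A (lc u c) + t *: A x).
Proof.
move=> d0 eta1; have eta0 : 0 < eta := lt_trans ltr01 eta1.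
have [CA CA1 AC] := bounded_ge1 A; have CA0 : 0 < CA := lt_le_trans ltr01 CA1.
have eta_inv : eta^-1 < 1 by rewrite invf_lt1.
pose kappa := (1 - eta^-1) / 3; have kappa0 : 0 < kappa by rewrite /kappa; lra.
have [I [code codeP]] : exists (I : finType) (code : (nat -> F) -> I), _ :=
  box_code n M (divr_gt0 kappa0 CA0).
(* More than m indices in one class are enough: the final contradiction
   is m * kappa <= CA / d. *)
pose m := Num.truncn (CA / (d * kappa)).
exists (#|I| * m.+1)%N => u v un upu upv low vd Nv.
apply: contrapT => none.
have bad (j : 'I_(size v)) : exists ct : (nat -> F) * F,
    nrm (A (lc u ct.1)) = 1 /\
    nrm (A (lc u ct.1) + ct.2 *: A v`_j) <= eta^-1.
  apply: contrapT => nobad; apply: none; exists v`_j; first exact: mem_nth.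
  move=> c t; rewrite leNgt; apply/negP => ct; apply: nobad.
  have e0 : 0 < nrm (A (lc u c)).
    by apply: le_lt_trans ct; rewrite mulr_ge0 ?nrm_ge0 // ltW.
  set e := nrm _ in e0 ct.
  exists (fun i => of_real k e^-1 * c i, of_real k e^-1 * t) => /=.
  rewrite lcZ linearZ -scalerA -scalerDr !nrmZ absv_of_real.
  rewrite ger0_norm ?invr_ge0 ?(ltW e0) //; split.
    by rewrite -/e mulVf // gt_eqF.
  by rewrite ler_pdivrMl // mulrC ler_pdivlMl // ltW.
have [ct ctP] := choice bad.
have [i mi] := @large_fiber _ _ _ (fun j => code (ct j).1) Nv.
set J := [pred j | _] in mi.
have [j0 j0J] : exists j, j \in J.
  by apply/card_gt0P; exact: leq_trans mi.
pose e := A (lc u (ct j0).1).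
have e1 : nrm e = 1 := (ctP j0).1.
have cM j l : (l < n)%N -> absv ((ct j).1 l) <= M.
  by move=> ln; apply: le_trans (low _ _ ln) _; rewrite (ctP j).1 mulr1.
have near j : j \in J -> nrm (e + (ct j).2 *: A v`_j) <= eta^-1 + kappa.
  move=> jJ; have := (ctP j).2; set ej := A (lc u (ct j).1) => ejP.
  have ee : nrm (e - ej) <= kappa.
    rewrite /e /ej -linearB -lcB; apply: le_trans (AC _) _.
    rewrite mulrC -ler_pdivlMr //; apply: le_trans (upu _) _ => /=.
    apply: bigmax_le => [|l _]; first by rewrite divr_ge0 ?ltW.
    apply: (codeP (ct j0).1 (ct j).1); [exact: cM|exact: cM| |].
      by rewrite (eqP j0J) (eqP jJ).
    by rewrite -un.
  rewrite -[e](subrK ej) -addrA addrC; apply: le_trans (nrmD _ _) _.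
  exact: lerD.
have tj j : absv (ct j).2 <= 2 / d.
  rewrite ler_pdivlMr //.
  apply: le_trans (_ : absv (ct j).2 * nrm (A v`_j) <= _).
    by rewrite ler_wpM2l ?absv_ge0 // vd // mem_nth.
  rewrite -nrmZ.
  have := ctP j; set ej := A (lc u (ct j).1) => -[ej1 ejP].
  have := nrmB ((ct j).2 *: A v`_j) (- ej).
  rewrite nrmN ej1 opprK (addrC (_ *: _) ej) => /le_trans/(_ ejP).
  rewrite lerBlDr => /le_trans; apply.
  by rewrite [leRHS](_ : 2 = 1 + 1) ?lerD2r ?(ltW eta_inv).
pose b l : F := if insub l is Some j then if j \in J then (ct j).2 else 0 else 0.
have sumE : \sum_(j in J) (ct j).2 *: A v`_j = A (lc v b).
  rewrite /lc linear_sum [RHS](bigID (mem J)) /= [X in _ + X]big1 ?addr0.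
    by apply: eq_bigr => j jJ; rewrite linearZ_LR /b valK jJ.
  by move=> j jJ; rewrite /b valK (negPf jJ) scale0r linear0.
have sum_le : nrm (\sum_(j in J) (ct j).2 *: A v`_j) <= CA * (2 / d).
  rewrite sumE; apply: le_trans (AC _) _; rewrite ler_pM2l //.
  apply: le_trans (upv _) _ => /=; apply: bigmax_le => [|l _].
    by rewrite divr_ge0 // ltW.
  by rewrite /b valK; case: ifP => // _; rewrite absv0 divr_ge0 // ltW.
have : nrm (e *+ #|J|) <= (eta^-1 + kappa) *+ #|J| + CA * (2 / d).
  have -> : e *+ #|J| = \sum_(j in J) (e + (ct j).2 *: A v`_j) -
      \sum_(j in J) (ct j).2 *: A v`_j.
    by rewrite big_split /= addrK sumr_const.
  apply: le_trans (nrmD _ _) _; rewrite nrmN; apply: lerD => //.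
  by apply: le_trans (nrm_sum _ _ _) _; rewrite -sumr_const; exact: ler_sum.
rewrite nrmMn e1 -(mulr_natr (_ + _)).
have mJ : CA / (d * kappa) < #|J|%:R.
  apply: lt_le_trans (truncnS_gt _) _; rewrite ler_nat; exact: leq_trans mi.
have : CA * (2 / d) < 2 * kappa * #|J|%:R.
  move: mJ; rewrite invfM mulrA ltr_pdivrMr // => mJ.
  by rewrite mulrCA -mulrA ltr_pM2l // [kappa * _]mulrC.
have -> : eta^-1 = 1 - 3 * kappa by rewrite /kappa; lra.
move: #|J|%:R (CA * (2 / d)) => x y; rewrite -subr_gt0 -subr_ge0.
set lhs := (X in 0 < X -> _); set rhs := (X in _ -> 0 <= X -> _).
have -> : rhs = - lhs by rewrite /rhs /lhs; ring.
by rewrite oppr_ge0 leNgt => ->.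
Qed.

End C0.

(** * Lower c_0 estimates along trees *)

Section C0Trees.
Variables (R : realType) (k : scalar_kind).
Local Notation F := (scal R k).
Local Notation banach := (completeNormedModType F).
Implicit Types (X Y : banach) (K M : R) (c : nat -> F).

Definition seminormalized X Y (A : X -> Y) (d : R) : set (seq X) :=
  [set s | upper_p +oo s /\ forall x, x \in s -> d <= nrm (A x)].

Lemma is_tree_seminormalized X Y (A : X -> Y) d : is_tree (seminormalized A d).
Proof.
move=> s v [up low]; split.
  by apply: upper_block up; apply: block_catl; rewrite leey.
by move=> x xs; apply: low; rewrite mem_cat xs.
Qed.

(** Basic sequences, by the norms of the initial projections. *)
Definition basic X Y (A : X -> Y) (theta : R) (u : seq X) : Prop :=
  forall c n, (n <= size u)%N ->
    nrm (A (lc (take n u) c)) <= theta * nrm (A (lc u c)).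

(** The i-th term is a difference of two partial sums, each of norm at most
    twice the norm of the whole sum. *)
Lemma basic_lower X Y (A : operator X Y) d theta (u : seq X) : 0 < d ->
  theta <= 2 -> basic A theta u -> (forall x, x \in u -> d <= nrm (A x)) ->
  forall c i, (i < size u)%N -> absv (c i) <= 4 / d * nrm (A (lc u c)).
Proof.
move=> d0 theta2 bas low c i iu; rewrite mulrAC ler_pdivlMr //.
apply: le_trans (_ : absv (c i) * nrm (A u`_i) <= _).
  by rewrite ler_wpM2l ?absv_ge0 // low // mem_nth.
rewrite -nrmZ -linearZ.
have -> : c i *: u`_i = lc (take i.+1 u) c - lc (take i u) c.
  by rewrite (take_nth 0 iu) lc_rcons size_takel ?(ltnW iu) // addrAC subrr add0r.
rewrite linearB; apply: le_trans (nrmD _ _) _; rewrite nrmN.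
have two n : (n <= size u)%N ->
    nrm (A (lc (take n u) c)) <= 2 * nrm (A (lc u c)).
  by move=> nu; apply: le_trans (bas c n nu) _; rewrite ler_wpM2r // nrm_ge0.
have h1 := two _ iu; have h2 := two _ (ltnW iu).
by apply: le_trans (lerD h1 h2) _; rewrite -mulrDl -natrD.
Qed.

Lemma basic_rcons X Y (A : operator X Y) theta theta' (u : seq X) x :
  1 <= theta -> 1 <= theta' -> basic A theta u ->
  (forall c t, nrm (A (lc u c)) <=
     theta' / theta * nrm (A (lc u c) + t *: A x)) ->
  basic A theta' (rcons u x).
Proof.
move=> t1 t1' bas ext c n; rewrite size_rcons leq_eqVlt => /predU1P[->|].
  rewrite take_oversize ?size_rcons // ler_peMl ?nrm_ge0 //.
rewrite ltnS => nu; rewrite -cats1 takel_cat // cats1.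
apply: le_trans (bas c n nu) _.
rewrite lc_rcons linearD linearZ_LR -ler_pdivlMl ?(lt_le_trans ltr01) //.
by rewrite mulrA [_^-1 * _]mulrC; exact: ext.
Qed.

(** Each vector is chosen, by [next_basic], in a finite segment whose length is
    not bounded beforehand: a tree of order omega.  The basis constant
    increases at each step but stays below 2. *)
Lemma derived_c0 X Y (A : operator X Y) d b : 0 < d ->
  derived (seminormalized A d) (omul (opow oone) b) [::] ->
  derived (Tp +oo A (Num.max 1 (4 / d))) b [::].
Proof.
move=> d0; set T := seminormalized A d.
have p1 : (1%:E <= +oo :> \bar R)%E by rewrite leey.
apply: (derived_thinning (rel := fun _ s u => [/\ block +oo u s,
  forall x, x \in u -> d <= nrm (A x) &
  exists theta, [/\ 1 <= theta, theta < 2 & basic A theta u]])).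
- exact: is_tree_seminormalized.
- exact: is_tree_Tp.
- move=> _ s u [up _] [us low [theta [_ /ltW theta2 bas]]].
  apply/(TpP _ _ _ p1); split=> [|c]; first exact: upper_block us up.
  apply: bigmax_le => [|i _].
    by rewrite mulr_ge0 ?nrm_ge0 // le_max ler01.
  apply: le_trans (basic_lower d0 theta2 bas low _ (ltn_ord i)) _.
  by rewrite ler_wpM2r ?nrm_ge0 // le_max lexx orbT.
- move=> _ _ s u U _ [us low [theta [t1 t2 bas]]] treeU UT Us.
  have t0 : 0 < theta := lt_le_trans ltr01 t1.
  (* any constant strictly between theta and 2 *)
  pose theta' := (theta + 2) / 2.
  have tt' : theta < theta' by rewrite /theta'; lra.
  have t2' : theta' < 2 by rewrite /theta'; lra.
  have eta1 : 1 < theta' / theta by rewrite ltr_pdivlMr // mul1r.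
  have [N next] := next_basic A (4 / d) (size u) d0 eta1.
  have /(derived_onat treeU)[v vN Usv] : derived U (onat N.+1) s.
    by apply: derived_anti Us; exact/oltW/onat_lt_opow_oone.
  have [upsv lowsv] := UT _ Usv.
  have [|||||x xv ext] := next u v erefl.
  + apply: upper_block us _; apply: upper_block upsv; exact: block_catl.
  + exact: upper_catr upsv.
  + exact: basic_lower d0 (ltW t2) bas low.
  + by move=> x xv; apply: lowsv; rewrite mem_cat xv orbT.
  + by rewrite vN.
  exists (s ++ v), x; split=> //; split.
  + have /(nthP 0)[j jv <-] := xv; rewrite -lc_delta //.
    by apply: block_rcons => //; exact: lpnorm_delta.
  + move=> y; rewrite mem_rcons inE => /predU1P[->|]; last exact: low.
    by apply: lowsv; rewrite mem_cat xv orbT.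
  + exists theta'; split=> //; first exact: ltW (le_lt_trans t1 tt').
    by apply: basic_rcons ext => //; exact: ltW (le_lt_trans t1 tt').
- split=> //; first exact: block_nil.
  exists 1; split=> // [|c [|n] //=]; first by lra.
  by rewrite mul1r.
Qed.

End C0Trees.

(** * The operator ideals *)

Section Ideals.
Variables (R : realType) (k : scalar_kind).
Local Notation F := (scal R k).
Local Notation banach := (completeNormedModType F).
Implicit Types (W X Y Z : banach) (p : \bar R) (K C : R) (c : nat -> F).

Lemma sum_lpnorm p n c (eps : nat -> R) e : (1 <= p)%E ->
  (forall j, 0 <= eps j) -> \sum_(j < n) eps j <= e ->
  \sum_(j < n) absv (c j) * eps j <= e * lpnorm p n c.
Proof.
move=> p1 eps0 eps_e.
apply: le_trans (_ : (\sum_(j < n) eps j) * lpnorm p n c <= _).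
  rewrite mulr_suml; apply: ler_sum => j _.
  by rewrite mulrC ler_wpM2l // absv_le_lpnorm.
by rewrite ler_wpM2r // lpnorm_ge0.
Qed.

Lemma sum_half n : \sum_(j < n) (2 : R)^-1 ^+ j.+1 <= 1.
Proof.
suff -> : \sum_(j < n) (2 : R)^-1 ^+ j.+1 = 1 - 2^-1 ^+ n.
  by rewrite gerBl exprn_ge0.
elim: n => [|n IH]; first by rewrite big_ord0 expr0 subrr.
rewrite big_ord_recr /= IH exprS; move: (_ ^+ n) => t; lra.
Qed.

Lemma NPclass_compose p xi W X Y Z (B : operator W X) (A : operator X Y)
    (D : operator Y Z) (P : operator W Z) : (1 <= p)%E ->
  NPclass p xi A -> (forall w, P w = D (A (B w))) -> NPclass p xi P.
Proof.
move=> p1 /(NPclassP _ _ p1) NA /(derived_compose p1)[M M1 PA].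
apply/(NPclassP _ _ p1) => K K1 /(PA _ _ K1); apply: NA.
by rewrite mulr_ege1.
Qed.

Lemma linear_comb_bound X Y (A B S : operator X Y) (a : F) :
  (forall x, S x = a *: A x + B x) ->
  exists2 C : R, 1 <= C & forall x, nrm (S x) <= C * nrm (A x) + nrm (B x).
Proof.
move=> SE; exists (absv a + 1) => [|x]; first by rewrite lerDr absv_ge0.
rewrite SE; apply: le_trans (nrmD _ _) _; rewrite lerD2r nrmZ mulrDl mul1r.
by rewrite lerDl nrm_ge0.
Qed.

(** The constants eps_j are summable, hence they suit every p, but T_p(A, 1/eps_j)
    runs through infinitely many trees of A, of which only the common bound
    omega ^ x is known: the exponent becomes x + y. *)
Lemma NPclass_sum p x y X Y (A B S : operator X Y) (a : F) : (1 <= p)%E ->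
  NPclass p x A -> NPclass p y B -> (forall z, S z = a *: A z + B z) ->
  NPclass p (oadd x y) S.
Proof.
move=> p1 /(NPclassP _ _ p1) NA /(NPclassP _ _ p1) NB.
move=> /linear_comb_bound[C C1 SAB]; apply/(NPclassP _ _ p1) => K K1.
have K0 : 0 < K by lra.
have C0 : 0 < C by lra.
pose e := (2 * K * C)^-1; have e0 : 0 < e by rewrite invr_gt0 !mulr_gt0.
move=> /(derived_anti (omul_opow_le x y)).
move=> /(@derived_sum _ _ p _ _ A B S K C (fun n => e * 2^-1 ^+ n.+1)
  (fun _ _ => True) _ _ p1 K0 C0 SAB) D.
apply: (NB (2 * K)); first by lra.
apply: D => // [n|_ n c _|_ _ n _ _].
- by rewrite mulr_gt0 // exprn_gt0.
- have eps_e : \sum_(j < n) e * 2^-1 ^+ j.+1 <= e.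
    by rewrite -mulr_sumr -[leRHS]mulr1 ler_pM2l // sum_half.
  have eps0 j : 0 <= e * 2^-1 ^+ j.+1 by rewrite mulr_ge0 ?(ltW e0) // exprn_ge0.
  rewrite -ler_pdivlMl //; apply: le_trans (sum_lpnorm c p1 eps0 eps_e) _.
  by rewrite mulrA /e invfM [_^-1 * _]mulrC.
- split=> //; apply: NA; rewrite invfM invrK -exprVn invrK.
  apply: mulr_ege1; last by apply: exprn_ege1; rewrite ler1n.
  by apply: mulr_ege1 => //; apply: mulr_ege1 => //; rewrite ler1n.
Qed.

(** With one eps for all blocks, one tree of A and one tree of B occur for each
    K.  Their orders are at most omega ^ x and omega ^ y with x, y below
    omega ^ z, and then x + y is again below omega ^ z. *)
Lemma NPclass_sum_l1 z X Y (A B S : operator X Y) (a : F) : olt ozero z ->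
  NPclass 1%:E (opow z) A -> NPclass 1%:E (opow z) B ->
  (forall x, S x = a *: A x + B x) -> NPclass 1%:E (opow z) S.
Proof.
have p1 : (1%:E <= 1%:E :> \bar R)%E by [].
move=> z0 /(NPclassP _ _ p1) NA /(NPclassP _ _ p1) NB.
move=> /linear_comb_bound[C C1 SAB]; apply/(NPclassP _ _ p1) => K K1.
have K0 : 0 < K by lra.
have C0 : 0 < C by lra.
have lim := olimit_opow z0.
have [|x [xz Ax]] := not_derived_opow_lim lim (NA (2 * K * C) _).
  by rewrite !mulr_ege1 //; lra.
have [|y [yz By]] := not_derived_opow_lim lim (NB (2 * K) _).
  by rewrite mulr_ege1 //; lra.
have xyz : ole (omul (opow x) (opow y)) (opow (opow z)).
  apply: ole_trans (omul_opow_le _ _) _; apply: opow_mono; apply: oltW.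
  exact: opow_indecomposable.
move=> /(derived_anti xyz).
move=> /(@derived_sum _ _ 1%:E _ _ A B S K C (fun _ => (2 * K * C)^-1)
  (fun _ _ => True) _ _ p1 K0 C0 SAB) D.
apply: By; apply: D => // [n|_ n c _|_ _ n _ _].
- by rewrite invr_gt0 !mulr_gt0.
- rewrite -mulr_suml -lpnorm_l1.
  have -> : (2 * K)^-1 = C * (2 * K * C)^-1.
    by rewrite [(_ * C)^-1]invfM mulrCA mulfV ?mulr1 ?gt_eqF.
  by rewrite mulrA mulrAC.
- by rewrite invrK.
Qed.

(** The tree of B has a finite order m, so at most m blocks are chosen and
    eps = 1 / (2 K C (m + 1)) makes their total contribution small. *)
Lemma NPclass_sum_oone p X Y (A B S : operator X Y) (a : F) : (1 <= p)%E ->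
  NPclass p oone A -> NPclass p oone B ->
  (forall x, S x = a *: A x + B x) -> NPclass p oone S.
Proof.
move=> p1 /(NPclassP _ _ p1) NA /(NPclassP _ _ p1) NB.
move=> /linear_comb_bound[C C1 SAB]; apply/(NPclassP _ _ p1) => K K1.
have K0 : 0 < K by lra.
have C0 : 0 < C by lra.
have [|m Bm] := not_derived_opow_oone (NB (2 * K) _).
  by rewrite mulr_ege1 //; lra.
have m1 : 1 <= m.+1%:R :> R by rewrite ler1n.
pose e := (2 * K * C * m.+1%:R)^-1.
have e0 : 0 < e by rewrite invr_gt0 !mulr_gt0.
have [|n An] := not_derived_opow_oone (NA e^-1 _).
  by rewrite invrK !mulr_ege1 //; lra.
move=> /(derived_anti (oltW (omul_onat_lt_opow_oone n m))).
move=> /(@derived_sum _ _ p _ _ A B S K C (fun _ => e)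
  (fun d i => (i <= m)%N /\ ole d (onat (m - i))) _ _ p1 K0 C0 SAB) D.
apply: Bm; apply: D => // [_ i c [im _]|d' d i dd' [im di]|].
- rewrite -ler_pdivlMl //.
  have eps_e : \sum_(j < i) e <= (2 * K * C)^-1.
    rewrite sumr_const card_ord -[e *+ i]mulr_natr /e.
    rewrite [(_ * m.+1%:R)^-1]invfM -[_ * _ * i%:R]mulrA.
    rewrite ger_pMr ?invr_gt0 ?mulr_gt0 // ler_pdivrMl // mulr1 ler_nat.
    exact: leqW.
  apply: le_trans (sum_lpnorm c p1 (fun=> ltW e0) eps_e) _.
  by rewrite mulrA [_^-1 * _]mulrC -invfM.
- split=> //; have := olt_le_trans dd' di.
  case E: (m - i)%N => [|l] //=; first by case.
  by move=> [_ d'l]; rewrite -subn_gt0 E subnS E.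
- by split=> //; rewrite subn0; exact: ole_refl.
Qed.

(** On a sequence of the tree of the sum, a vector that is not bounded below by
    A is bounded below by B: apply the lower estimate to a coordinate vector. *)
Lemma NPclass_sum_c0 z X Y (A B S : operator X Y) (a : F) : ole oomega z ->
  NPclass +oo%E z A -> NPclass +oo%E z B ->
  (forall x, S x = a *: A x + B x) -> NPclass +oo%E z S.
Proof.
have p1 : (1%:E <= +oo :> \bar R)%E by rewrite leey.
move=> wz /(NPclassP _ _ p1) NA /(NPclassP _ _ p1) NB.
move=> /linear_comb_bound[C C1 SAB]; apply/(NPclassP _ _ p1) => K K1 Ds.
have K0 : 0 < K by lra.
have C0 : 0 < C by lra.
have no_seminormalized (D : operator X Y) d : 0 < d ->
    (forall K, 1 <= K -> ~ derived (Tp +oo%E D K) (opow z) [::]) ->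
    ~ derived (seminormalized D d) (opow z) [::].
  move=> d0 ND Dd; apply: (ND (Num.max 1 (4 / d))); first by rewrite le_max lexx.
  apply: derived_c0 => //; apply: derived_anti Dd.
  exact: ole_trans (omul_opow_le _ _) (opow_mono (oadd_oone_infinite wz)).
pose dA := (2 * K * C)^-1; have dA0 : 0 < dA by rewrite invr_gt0 !mulr_gt0.
pose dB := (2 * K)^-1; have dB0 : 0 < dB by rewrite invr_gt0 mulr_gt0.
have treeS : is_tree (Tp +oo%E S K) by exact: is_tree_Tp.
have [||||] := @splits_opow _ z _ (seminormalized A dA) (seminormalized B dB)
  (fun x => dA <= nrm (A x)) [::] [::] [::] treeS _ _ _ Ds.
- exact: is_tree_seminormalized.
- exact: is_tree_seminormalized.
- move=> v /(TpP _ _ _ p1)[up lo]; split; split.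
  + apply: upper_block up; exact: block_filter.
  + by move=> x; rewrite mem_filter => /andP[].
  + apply: upper_block up; exact: block_filter.
  + move=> x; rewrite mem_filter /= -ltNge => /andP[Ax /(nthP 0)[j jv xE]].
    have := lo (fun i => (i == j)%:R); rewrite lpnorm_delta // lc_delta // xE.
    have CA : C * nrm (A x) <= dB.
      by rewrite -ler_pdivlMl // mulrC -invfM ltW.
    rewrite -ler_pdivrMl // mulr1 => /le_trans/(_ (SAB x)).
    have -> : K^-1 = dB + dB by rewrite [LHS]splitr /dB invfM [2^-1 * _]mulrC.
    by move: CA; lra.
- exact: no_seminormalized.
- exact: no_seminormalized.
Qed.

Lemma operator_ideal_NPclass p xi : (1 <= p)%E -> ole oone xi ->
  (forall X Y (A B S : operator X Y) (a : F), NPclass p xi A ->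
    NPclass p xi B -> (forall x, S x = a *: A x + B x) -> NPclass p xi S) ->
  closed_operator_ideal (@NPclass R k p xi).
Proof.
move=> p1 xi1 sums; split; last exact: closed_NPclass.
split=> //; first by move=> X Y A; exact: finite_rank_NPclass.
by move=> W X Y Z B A D P; exact: NPclass_compose.
Qed.

End Ideals.

Theorem theorem3p7 (R : realType) (k : scalar_kind) (zeta : Ord) :
  olt ozero zeta ->
  (forall p : \bar R, (1%:E <= p)%E ->
     operator_ideal (fun X Y (A : @operator R k X Y) =>
       exists xi : Ord, olt xi (opow zeta) /\ NPclass p xi A))
  /\ closed_operator_ideal (@NPclass R k 1%:E (opow zeta))
  /\ (forall p : \bar R, (1%:E <= p)%E ->
       closed_operator_ideal (@NPclass R k p oone))
  /\ (ole oomega zeta -> closed_operator_ideal (@NPclass R k +oo%E zeta)).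
Proof.
move=> z0; split=> [p p1|]; first split.
- move=> X Y A fr; exists oone; split; first exact: oone_lt_opow.
  exact: finite_rank_NPclass (ole_refl _) fr.
- move=> X Y A B S a [x [xz Ax]] [y [yz By]] SE; exists (oadd x y).
  by split; [exact: opow_indecomposable|exact: NPclass_sum SE].
- move=> W X Y Z B A D P [x [xz Ax]] PE; exists x.
  by split=> //; exact: NPclass_compose PE.
split; last split=> [p p1|wz].
- apply: operator_ideal_NPclass => //; first exact: opow_ge1.
  by move=> X Y A B S a; exact: NPclass_sum_l1.
- apply: operator_ideal_NPclass => //; first exact: ole_refl.
  by move=> X Y A B S a; exact: NPclass_sum_oone.
- apply: operator_ideal_NPclass; first by rewrite leey.
    exact: osucc_le.
  by move=> X Y A B S a; exact: NPclass_sum_c0.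
Qed.
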